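(* Let $\{X_n\}_{n\ge0}$ be the $(2,1)$-reflecting random walk on $\mathbb{Z}^+=\{0,1,2,\ldots\}$ with parameters $(p(i),q_1(i),q_2(i))_{i\ge1}$. Assume $E^1\tau_1<\infty$. Then the walk is positive recurrent. Furthermore, its stationary distribution is given, for $i\ge0$, by $$\pi(i)=\frac1{E^iT_i}=\frac{1}{p(i)E^{i+1}\tau_{i+1}+\bigl(q_1(i)+q_2(i)+p(i)P^{i+1}[(i+1,+\infty),i-1]\bigr)E^{i-1}T_i+q_2(i)E^{i-2}T_{i-1}+1},$$ where $p(0)=1$, $q_1(0)=q_2(0)=0$, terms containing an expectation with a negative starting state are read as $0$, and the quantities involved have the following explicit expressions. (a) For $i\ge2$, with $S_{i,n}:=\tilde M_i+\tilde M_{i+1}\tilde M_i+\cdots+\tilde M_n\tilde M_{n-1}\cdots\tilde M_i$ for $n\ge i$, $$P^i[(i,n),i-1]=\frac{e_1S_{i,n}v}{1+e_1S_{i,n}e_1'},\qquad P^i[(i,n),i-2]=\frac{e_1S_{i,n}e_2'}{1+e_1S_{i,n}e_1'},$$ and $P^i[(i,+\infty),j]=\lim_{n\to\infty}P^i[(i,n),j]$ for $j\in\{i-1,i-2\}$. (b) For $i\ge1$, $$E^i\tau_i=1+\Bigl\langle(2,2,1),\ \frac{1}{1-\alpha(i)-\beta(i)}\bigl(q_1(i),\gamma(i),q_2(i)\bigr)\cdot\sum_{k=i}^{\infty}N_iN_{i+1}\cdots N_k\Bigr\rangle .$$ (c) For $i\ge0$, $$E^iT_{i+1}=1+\sum_{k=1}^{i}e_1M_iM_{i-1}\cdots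 M_{i-k+1}(2,1)'.$$
   Context: The $(2,1)$-reflecting random walk is the Markov chain $\{X_n\}_{n\ge0}$ on $\mathbb{Z}^+=\{0,1,2,\ldots\}$ with $X_0=0$ and the following transition probabilities. For each $i\ge1$ we are given $q_1(i),q_2(i)\ge 0$ and $0<p(i)<1$ with $q_1(i)+q_2(i)+p(i)=1$. Then $P_{01}=p(0)=1$; $P_{12}=p(1)$ and $P_{10}=q_1(1)+q_2(1)$; and for $i\ge2$, $P_{i,i+1}=p(i)$, $P_{i,i-1}=q_1(i)$, $P_{i,i-2}=q_2(i)$; all other transition probabilities are $0$. The chain is irreducible. $P^i$ and $E^i$ denote probability and expectation for the walk (same transition probabilities) started at $X_0=i$. $T_i=\inf\{n>0:X_n=i\}$; $\tau_0=0$ and $\tau_i=\inf\{n>0:X_n<i\}$ for $i\ge1$. For $i\le n\le+\infty$ and $j<i$, $P^i[(i,n),j]$ is the probability, for the walk started at $i$, that the walk leaves the set $\{i,i+1,\ldots,n\}$ (the set $\{i,i+1,\ldots\}$ if $n=+\infty$) at the point $j$, i.e. that its first position outside this set is $j$. Notation: $e_1=(1,0)$, $e_2=(0,1)$ are row vectors, prime denotes transpose, $v=e_1'-e_2'$, $\langle\cdot,\cdot\rangle$ is the standard inner product, and $$M_1=\begin{pmatrix}\frac{q_1(1)+q_2(1)}{p(1)}&0\\ \frac1{p(1)}&0\end{pmatrix},\qquad M_i=\begin{pmatrix}\frac{q_1(i)}{p(i)}&\frac{q_2(i)}{p(i)}\\ 1+\frac{q_1(i)}{p(i)}&\frac{q_2(i)}{p(i)}\end{pmatrix}\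 (i>1),\qquad \tilde M_i=\begin{pmatrix}\frac{q_1(i)+q_2(i)}{p(i)}&\frac{q_2(i)}{p(i)}\\ 1&0\end{pmatrix}\ (i\ge1).$$ For $i\ge1$, $$\gamma(i)=p(i)P^{i+1}[(i+1,+\infty),i-1],$$ $$\alpha(i)=p(i)P^{i+1}[(i+1,+\infty),i]\,\frac{q_1(i+1)}{q_1(i+1)+\gamma(i+1)},\qquad \beta(i)=p(i)P^{i+1}[(i+1,+\infty),i]\,\frac{\gamma(i+1)}{q_1(i+1)+\gamma(i+1)}$$ (with $0/0$ read as $0$), and $$N_k=\begin{pmatrix}\frac{\alpha(k)}{1-\alpha(k)-\beta(k)}&\frac{\beta(k)}{1-\alpha(k)-\beta(k)}&0\\ \frac{\alpha(k)}{1-\alpha(k)-\beta(k)}&\frac{\beta(k)}{1-\alpha(k)-\beta(k)}&1\\ \frac{\alpha(k)}{1-\alpha(k)-\beta(k)}&\frac{\beta(k)}{1-\alpha(k)-\beta(k)}&0\end{pmatrix},\quad k\ge1.$$ *)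

(* Defs.v *)
From HB Require Import structures.
From mathcomp Require Import all_boot all_order all_algebra.
From mathcomp Require Import all_classical all_reals all_analysis.

Set Implicit Arguments.
Unset Strict Implicit.
Unset Printing Implicit Defensive.

Import Order.TTheory GRing.Theory Num.Theory.
Import numFieldNormedType.Exports.

Local Open Scope classical_set_scope.
Local Open Scope ring_scope.

Definition mx_of_rows (R : nmodType) m n (rows : seq (seq R)) : 'M[R]_(m, n) :=
  \matrix_(i < m, j < n) nth 0 (nth [::] rows i) j.

Definition dot (R : pzRingType) n (u v : 'rV[R]_n) : R := (u *m v^T) 0 0.

(* A k * A (k - 1) * ... * A (k - m + 1), with m factors *)
Definition desc_prod (R : nzRingType) (A : nat -> R) (k m : nat) : R :=
  \prod_(0 <= l < m) A (k - l)%N.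

Section Coefficients.
Context {R : realType}.
Variables p q1 q2 : nat -> R.

(* The values at 0 are the conventions p(0) = 1, q1(0) = q2(0) = 0. *)
Definition walk_parameters : Prop :=
  [/\ p 0 = 1, q1 0 = 0, q2 0 = 0 &
      forall i, (1 <= i)%N ->
        [/\ 0 <= q1 i, 0 <= q2 i, 0 < p i < 1 & q1 i + q2 i + p i = 1]].

Definition walk_trans (i j : nat) : R :=
  match i with
  | 0 => if j == 1%N then p 0 else 0
  | 1 => if j == 2%N then p 1 else if j == 0%N then q1 1 + q2 1 else 0
  | k.+2 => if j == i.+1 then p i
            else if j == k.+1 then q1 i
            else if j == k then q2 i else 0
  end.

(* Only used for 1 <= i. *)
Definition Mmx (i : nat) : 'M[R]_2 :=
  if i == 1%N then
    mx_of_rows 2 2 [:: [:: (q1 1 + q2 1) / p 1; 0];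
                       [:: 1 / p 1;             0]]
  else
    mx_of_rows 2 2 [:: [:: q1 i / p i;     q2 i / p i];
                       [:: 1 + q1 i / p i; q2 i / p i]].

Definition Mtilde (i : nat) : 'M[R]_2 :=
  mx_of_rows 2 2 [:: [:: (q1 i + q2 i) / p i; q2 i / p i];
                     [:: 1;                   0]].

Definition Smx (i n : nat) : 'M[R]_2 :=
  \sum_(i <= k < n.+1) desc_prod Mtilde k (k - i).+1.

End Coefficients.

Section Probability.
Context {R : realType} {d : measure_display} {Omega : measurableType d}.

(* P i is the law of the chain started at i, and Q the transition matrix. The
   last clause is P(X_{n+1} = y | X_0 = x_0, ..., X_n = x_n) = Q(x_n, y) with
   the conditioning event, possibly null, multiplied out. *)
Definition markov_chain (Q : nat -> nat -> R)
    (P : nat -> probability Omega R) (X : nat -> Omega -> nat) : Prop :=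
  [/\ forall n, measurable_fun setT (X n),
      forall i, P i [set w | X 0 w = i] = 1%E &
      forall (i n : nat) (x : nat -> nat) (y : nat),
        P i [set w | (forall k, (k <= n)%N -> X k w = x k) /\ X n.+1 w = y]
        = (P i [set w | forall k, (k <= n)%N -> X k w = x k]
           * (Q (x n) y)%:E)%E].

Definition stationary (Q : nat -> nat -> R) (mu : nat -> R) : Prop :=
  [/\ forall i, 0 <= mu i,
      (\sum_(0 <= i <oo) (mu i)%:E = 1)%E &
      forall j, (\sum_(0 <= i <oo) (mu i * Q i j)%:E = (mu j)%:E)%E].

Variables (P : nat -> probability Omega R) (X : nat -> Omega -> nat).

(* inf {n > 0 : X_n \in A}, equal to +oo if A is never visited after time 0 *)
Definition first_time (A : set nat) (w : Omega) : \bar R :=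
  ereal_inf [set n%:R%:E | n in [set n | (0 < n)%N /\ A (X n w)]].

Definition T_ (i : nat) : Omega -> \bar R := first_time [set i].

Definition tau (i : nat) : Omega -> \bar R :=
  if i == 0%N then (fun=> 0%E) else first_time [set k | (k < i)%N].

(* The expectation from a negative starting state is read as 0. *)
Definition E_ (s : int) (f : Omega -> \bar R) : \bar R :=
  match s with
  | Posz i => (\int[P i]_w f w)%E
  | Negz _ => 0%E
  end.

Definition positive_recurrent : Prop := forall i : nat, (E_ i (T_ i) < +oo)%E.

(* The probability, from i, that the first position outside A is j. *)
Definition exit_prob (i : nat) (A : set nat) (j : int) : R :=
  fine (P i [set w | exists m, [/\ Posz (X m w) = j, ~ A (X m w) &
                                   forall k, (k < m)%N -> A (X k w)]]).

(* P^i[(i, n), j] and P^i[(i, +oo), j] *)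
Definition exit_below (i n : nat) (j : int) : R :=
  exit_prob i [set k | (i <= k <= n)%N] j.

Definition exit_below_oo (i : nat) (j : int) : R :=
  exit_prob i [set k | (i <= k)%N] j.

Section Excursions.
Variables p q1 q2 : nat -> R.

Definition gamma (i : nat) : R := p i * exit_below_oo i.+1 (i%:Z - 1).

(* 0 / 0 = 0 holds for the division of a field. *)
Definition alpha (i : nat) : R :=
  p i * exit_below_oo i.+1 i * (q1 i.+1 / (q1 i.+1 + gamma i.+1)).

Definition beta (i : nat) : R :=
  p i * exit_below_oo i.+1 i * (gamma i.+1 / (q1 i.+1 + gamma i.+1)).

Definition Nmx (k : nat) : 'M[R]_3 :=
  let a := alpha k / (1 - alpha k - beta k) in
  let b := beta k / (1 - alpha k - beta k) in
  mx_of_rows 3 3 [:: [:: a; b; 0];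
                     [:: a; b; 1];
                     [:: a; b; 0]].

(* Partial sums, over k < n, of the series of the N_i N_{i+1} ... N_k, k >= i *)
Definition N_series (i n : nat) : 'M[R]_3 :=
  \sum_(i <= k < n) \prod_(i <= l < k.+1) Nmx l.

Definition stationary_denom (i : nat) : \bar R :=
  ((p i)%:E * E_ i.+1 (tau i.+1)
   + (q1 i + q2 i + p i * exit_below_oo i.+1 (i%:Z - 1))%:E
     * E_ (i%:Z - 1) (T_ i)
   + (q2 i)%:E * E_ (i%:Z - 2) (T_ i.-1) + 1)%E.

End Excursions.

End Probability.

(* Main.v *)
Require Import Defs.
From HB Require Import structures.
From mathcomp Require Import all_boot all_order all_algebra.
From mathcomp Require Import all_classical all_reals all_analysis.
From mathcomp Require Import zify ring lra.

Set Implicit Arguments.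
Unset Strict Implicit.
Unset Printing Implicit Defensive.

Import Order.TTheory GRing.Theory Num.Theory.
Import numFieldNormedType.Exports.

Local Open Scope classical_set_scope.
Local Open Scope ring_scope.

(** All the probabilities and expectations of the statement have the form
    sum_r (1_A Q)^r b, where Q is the transition operator ([step]), A is the set
    in which the walk has to stay, and the reward b is the indicator of A for an
    expected exit time and of a point outside A for an exit probability.
    [green A b w] says that this series converges to w.  Its sum is the least
    nonnegative solution of w = b + 1_A Q w, and this minimality does the work
    of the strong Markov property: for A' inside A, w is also the potential
    for A' with boundary values w off A' ([green_restrict]).  The process itself
    enters only through the probability that consecutive positions lie in
    prescribed sets ([history_follows]).

    The walk goes down by at most two, hence it leaves {i+1, i+2, ...} at i or
    at i - 1, and the value of a potential at i + 1 is an affine function of its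
    values at i and i - 1 ([level_split]).  For E^i tau_i this gives the
    recursion E^i tau_i * den i = 1 + p(i) E^{i+1} tau_{i+1}, where
    den i = 1 - p(i) P^{i+1}[(i+1,oo),i], and thus the series of the expected
    numbers [visits i k] of visits to k before the walk falls below i
    ([visits_cvg]).

    For the formula with the matrices N_k, a passage from {k, k+1, ...} to its
    complement has one of three types: a step from k to k - 1, a jump from k + 1
    to k - 1, a jump from k to k - 2.  The expected numbers of passages of each
    type at level k are the entries of [visits i k *: types k], and N_k maps
    this row to the row of level k + 1 ([types_offspring]).  The weights
    (2, 2, 1) count all the steps of the walk ([weigh_types]).  The formula for
    E^i T_{i+1} and the one for the exit from {i, ..., n} are linear
    recursions for the increments of a potential ([climb_step], [window_exit]).

    Every stationary distribution mu satisfies mu(i) E^i T_i = 1 ([kac]), which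
    gives uniqueness; the expected occupation of an excursion from 0, normalised,
    is stationary ([occupation_invariant]).  The denominator in the statement is
    the decomposition of E^i T_i after the first step, where an excursion above i
    is split by [level_split] and a climb from i - 2 to i is cut at i - 1
    ([retE]). *)

(** * Limits and series *)

Lemma eq_cvgn (T : topologicalType) (u v : nat -> T) (l : T) :
  u =1 v -> v @ \oo --> l -> u @ \oo --> l.
Proof. by move=> /funext->. Qed.

Lemma eventually_eq_cvgn (T : ptopologicalType) (N : nat) (u v : nat -> T) (l : T) :
  (forall n, (N <= n)%N -> u n = v n) -> v @ \oo --> l -> u @ \oo --> l.
Proof.
move=> uv vl; rewrite -(cvg_shiftn N); rewrite -(cvg_shiftn N) in vl.
by apply: eq_cvgn vl => n /=; rewrite uv// leq_addl.
Qed.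

Lemma cvgn_unique (R : realType) (u : nat -> R) (a b : R) :
  u @ \oo --> a -> u @ \oo --> b -> a = b.
Proof. by move=> ua ub; rewrite -(cvg_lim (@Rhausdorff R) ua) (cvg_lim _ ub). Qed.

Lemma cvgn_sum (R : realType) (N : nat) (f : 'I_N -> nat -> R) (l : 'I_N -> R) :
  (forall j, f j @ \oo --> l j) ->
  \sum_(j < N) f j n @[n --> \oo] --> \sum_(j < N) l j.
Proof.
elim: N f l => [|N IH] f l fl.
  rewrite big_ord0; apply: eq_cvgn (cvg_cst _) => n; exact: big_ord0.
apply: (@eq_cvgn _ _ (fun n => f ord0 n + \sum_(j < N) f (lift ord0 j) n)).
  by move=> n; rewrite big_ord_recl.
rewrite big_ord_recl; apply: cvgD; first exact: fl.
by apply: IH => j; exact: fl.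
Qed.

Lemma cvgn_mx (R : realType) (m n : nat) (F : nat -> 'M[R]_(m, n)) (L : 'M[R]_(m, n)) :
  (forall i j, F k i j @[k --> \oo] --> L i j) -> F @ \oo --> L.
Proof.
move=> FL; apply/cvg_ballP => e e0.
have h : \forall k \near \oo, forall i j, ball (L i j) e (F k i j).
  apply: filter_forall => i; apply: filter_forall => j.
  by move/cvg_ballP : (FL i j); apply.
by apply: filterS h => k hk; split.
Qed.

Lemma eseries_EFin (R : realType) (u : nat -> R) (l : R) :
  \sum_(0 <= k < n) u k @[n --> \oo] --> l -> (\sum_(0 <= k <oo) (u k)%:E = l%:E)%E.
Proof.
move=> ul; apply/cvg_lim => //; apply: cvg_EFin.
  by apply: nearW => n; rewrite sumEFin.
by apply: eq_cvgn ul => n /=; rewrite sumEFin.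
Qed.

Lemma eseries_EFin_cvg (R : realType) (u : nat -> R) (l : R) : (forall k, 0 <= u k) ->
  (\sum_(0 <= k <oo) (u k)%:E = l%:E)%E -> \sum_(0 <= k < n) u k @[n --> \oo] --> l.
Proof.
move=> u0 ul; have c : cvgn (fun n => \sum_(0 <= k < n) (u k)%:E)%E.
  by apply: is_cvg_nneseries => n _ _; rewrite lee_fin.
move/cvg_ex : c => [l' c]; have := cvg_lim (@ereal_hausdorff R) c.
rewrite ul => ll'; rewrite -ll' in c; have h : fine \o (fun n => \sum_(0 <= k < n) (u k)%:E)%E @ \oo --> l.
  exact: fine_cvg c.
by apply: eq_cvgn h => n /=; rewrite sumEFin.
Qed.

Lemma cvg_sum_finsupp (R : realType) (u : nat -> R) (N : nat) :
  (forall k, (N <= k)%N -> u k = 0) ->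
  \sum_(0 <= k < n) u k @[n --> \oo] --> \sum_(0 <= k < N) u k.
Proof.
move=> u0; apply: (@eventually_eq_cvgn _ N _ (fun=> \sum_(0 <= k < N) u k)).
  move=> n Nn; rewrite (big_cat_nat (leq0n N) Nn)//= [X in _ + X]big_nat.
  by rewrite [X in _ + X]big1 ?addr0// => k /andP[/u0].
exact: cvg_cst.
Qed.

Lemma cvg_sum_point (R : realType) (g : nat -> R) (a : nat) :
  \sum_(0 <= k < n) (k == a)%:R * g k @[n --> \oo] --> g a.
Proof.
have := @cvg_sum_finsupp _ (fun k => (k == a)%:R * g k) a.+1.
rewrite big_nat_recr//= eqxx mul1r big_nat big1 ?add0r.
  by apply=> k ak; rewrite gtn_eqF ?mul0r.
by move=> k /andP[_ ka]; rewrite ltn_eqF ?mul0r.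
Qed.

(** * Potentials of the killed walk *)

Section Potential.
Context {R : realType}.
Variables p q1 q2 : nat -> R.
Hypothesis hpar : walk_parameters p q1 q2.

(** The transition operator.  The truncated subtractions give the walk near the
    boundary, since q1 0 = q2 0 = 0 and both downward moves from 1 lead to 0. *)
Definition step (f : nat -> R) (x : nat) : R :=
  p x * f x.+1 + q1 x * f x.-1 + q2 x * f x.-2.

Definition kill (A : pred nat) (f : nat -> R) (x : nat) : R :=
  if A x then step f x else 0.

Definition ind (B : pred nat) (x : nat) : R := (B x)%:R.

Definition psum (A : pred nat) (b : nat -> R) (n x : nat) : R :=
  \sum_(0 <= r < n) iter r (kill A) b x.

(** Convergence to a real function instead of a sum in the extended reals: the
    potentials below are all finite, and they are combined linearly. *)
Definition green (A : pred nat) (b w : nat -> R) : Prop :=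
  forall x, psum A b n x @[n --> \oo] --> w x.

Lemma par_ge0 x : [/\ 0 < p x, 0 <= p x, 0 <= q1 x, 0 <= q2 x & q1 x + q2 x + p x = 1].
Proof.
case: hpar => p0 q10 q20 h; case: x => [|x].
  by rewrite p0 q10 q20 ltr01 ler01 lexx !add0r.
by have [//| ? ? /andP[? _] ?] := h x.+1; split => //; apply: ltW.
Qed.

Lemma step_cst c x : step (fun=> c) x = c.
Proof.
have [_ _ _ _ h] := par_ge0 x.
by rewrite /step -[RHS]mul1r -h; ring.
Qed.

Lemma eq_step f g x : f =1 g -> step f x = step g x.
Proof. by move=> fg; rewrite /step !fg. Qed.

Lemma le_step f g x : (forall y, f y <= g y) -> step f x <= step g x.
Proof.
move=> fg; have [_ ? ? ? _] := par_ge0 x.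
by rewrite /step !lerD// ler_wpM2l.
Qed.

Lemma step_ge0 f x : (forall y, 0 <= f y) -> 0 <= step f x.
Proof. by move=> f0; rewrite -(step_cst 0 x) le_step. Qed.

Lemma stepD f g x : step (fun y => f y + g y) x = step f x + step g x.
Proof. rewrite /step; ring. Qed.

Lemma stepZ c f x : step (fun y => c * f y) x = c * step f x.
Proof. rewrite /step; ring. Qed.

Lemma step_sum n (f : nat -> nat -> R) x :
  step (fun y => \sum_(0 <= r < n) f r y) x = \sum_(0 <= r < n) step (f r) x.
Proof. by rewrite /step !mulr_sumr -!big_split. Qed.

Lemma step_cvg (f : nat -> nat -> R) g x :
  (forall y, f n y @[n --> \oo] --> g y) ->
  step (f n) x @[n --> \oo] --> step g x.
Proof.
by move=> fg; rewrite /step; apply: cvgD; [apply: cvgD|]; (apply: cvgM; [exact: cvg_cst|exact: fg]).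
Qed.

Lemma killT (A : pred nat) f x : A x -> kill A f x = step f x.
Proof. by rewrite /kill => ->. Qed.

Lemma killF (A : pred nat) f x : ~~ A x -> kill A f x = 0.
Proof. by rewrite /kill => /negbTE->. Qed.

Lemma eq_kill A f g : f =1 g -> kill A f =1 kill A g.
Proof. by move=> fg x; rewrite /kill (eq_step _ fg). Qed.

Lemma le_kill A f g x : (forall y, f y <= g y) -> kill A f x <= kill A g x.
Proof. by move=> fg; rewrite /kill; case: ifP => // _; exact: le_step. Qed.

Lemma kill_ge0 A f x : (forall y, 0 <= f y) -> 0 <= kill A f x.
Proof. by move=> fg; rewrite /kill; case: ifP => // _; exact: step_ge0. Qed.

Lemma kill1 A : kill A (fun=> 1) =1 ind A.
Proof. by move=> x; rewrite /kill step_cst /ind; case: (A x). Qed.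

Lemma ind_ge0 B x : 0 <= ind B x.
Proof. by rewrite /ind ler0n. Qed.

Lemma killD A f g x : kill A (fun y => f y + g y) x = kill A f x + kill A g x.
Proof. by rewrite /kill; case: ifP => _; rewrite ?addr0// stepD. Qed.

Lemma killZ A c f x : kill A (fun y => c * f y) x = c * kill A f x.
Proof. by rewrite /kill; case: ifP => _; rewrite ?mulr0// stepZ. Qed.

Lemma iter_kill_eq A f g n : f =1 g -> iter n (kill A) f =1 iter n (kill A) g.
Proof. by move=> fg; elim: n => [|n IH] //= x; apply: eq_kill. Qed.

Lemma iter_kill_ge0 A b n x : (forall y, 0 <= b y) -> 0 <= iter n (kill A) b x.
Proof. by move=> b0; elim: n x => [|n IH] x //=; apply: kill_ge0. Qed.

Lemma psumSr A b n x : psum A b n.+1 x = psum A b n x + iter n (kill A) b x.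
Proof. by rewrite /psum big_nat_recr. Qed.

Lemma psumS A b n x : psum A b n.+1 x = b x + kill A (psum A b n) x.
Proof.
rewrite /psum big_nat_recl//; congr (_ + _); have [Ax|Ax] := boolP (A x).
  by rewrite killT// step_sum; apply: eq_bigr => r _; rewrite iterS killT.
by rewrite killF// big1// => r _; rewrite iterS killF.
Qed.

Lemma psum0 A b x : psum A b 0 x = 0.
Proof. by rewrite /psum big_geq. Qed.

Lemma psum_ge0 A b n x : (forall y, 0 <= b y) -> 0 <= psum A b n x.
Proof. by move=> b0; apply: sumr_ge0 => r _; apply: iter_kill_ge0. Qed.

Lemma psum_nd A b x : (forall y, 0 <= b y) -> nondecreasing_seq (psum A b ^~ x).
Proof.
by move=> b0; apply/nondecreasing_seqP => n; rewrite psumSr lerDl iter_kill_ge0.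
Qed.

Lemma eq_psum A b1 b2 n : b1 =1 b2 -> psum A b1 n =1 psum A b2 n.
Proof. by move=> bb x; apply: eq_bigr => r _; apply: iter_kill_eq. Qed.

Lemma green_unique A b w1 w2 : green A b w1 -> green A b w2 -> w1 =1 w2.
Proof. by move=> g1 g2 x; exact: cvgn_unique (g1 x) (g2 x). Qed.

Lemma eq_green A b1 b2 w : b1 =1 b2 -> green A b1 w -> green A b2 w.
Proof.
move=> bb g x; apply: eq_cvgn (g x) => n.
by rewrite (eq_psum A n bb).
Qed.

Lemma green_fix A b w x : green A b w -> w x = b x + kill A w x.
Proof.
move=> g; have h1 : psum A b n.+1 x @[n --> \oo] --> w x.
  by rewrite (cvg_shiftS (psum A b ^~ x)); exact: g.
apply: cvgn_unique h1 _.
apply: (@eq_cvgn _ _ (fun n => b x + kill A (psum A b n) x)).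
  by move=> n; exact: psumS.
apply: cvgD; first exact: cvg_cst.
rewrite /kill; case: ifP => _; last exact: cvg_cst.
by apply: step_cvg.
Qed.

Lemma psum_le_supersol A b v n x : (forall y, 0 <= v y) ->
  (forall y, b y + kill A v y <= v y) -> psum A b n x <= v x.
Proof.
move=> v0 hv; elim: n x => [|n IH] x; first by rewrite psum0.
by rewrite psumS (le_trans _ (hv x))// lerD2l le_kill.
Qed.

Lemma psum_le_green A b w n x : (forall y, 0 <= b y) -> green A b w ->
  psum A b n x <= w x.
Proof.
move=> b0 g; have := nondecreasing_cvgn_le (psum_nd A x b0) (cvgP _ (g x)) n.
by move/le_trans; apply; rewrite (cvg_lim _ (g x)).
Qed.

Lemma green_ge0 A b w x : (forall y, 0 <= b y) -> green A b w -> 0 <= w x.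
Proof. by move=> b0 /(psum_le_green 0 x b0); rewrite psum0. Qed.

Lemma green_min A b w v x : green A b w -> (forall y, 0 <= v y) ->
  (forall y, b y + kill A v y <= v y) -> w x <= v x.
Proof.
move=> g v0 hv; apply: cvgr_to_le (g x) _; apply: nearW => n.
exact: psum_le_supersol.
Qed.

(** A finite supersolution is a certificate of finiteness; the expectations below
    are shown to be finite in this way. *)
Lemma green_exists A b v : (forall y, 0 <= b y) -> (forall y, 0 <= v y) ->
  (forall y, b y + kill A v y <= v y) ->
  exists w, [/\ green A b w, forall x, 0 <= w x & forall x, w x <= v x].
Proof.
move=> b0 v0 hv.
have g : green A b (fun x => limn (psum A b ^~ x)).
  move=> x; apply: nondecreasing_is_cvgn; first exact: psum_nd.
  by exists (v x) => _ [n _ <-]; apply: psum_le_supersol.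
eexists; split; first exact: g.
  by move=> x; apply: (green_ge0 _ b0 g).
by move=> x; apply: (green_min _ g v0 hv).
Qed.

Lemma green_of_supersol_min A b w : (forall y, 0 <= b y) -> (forall y, 0 <= w y) ->
  (forall y, b y + kill A w y <= w y) ->
  (forall v, (forall y, 0 <= v y) -> (forall y, b y + kill A v y <= v y) ->
     forall x, w x <= v x) -> green A b w.
Proof.
move=> b0 w0 hw wmin; have [u [gu u0 uw]] := green_exists b0 w0 hw.
suff <- : u = w by [].
apply/funext => x; apply/eqP; rewrite eq_le uw/=; apply: wmin => // y.
by rewrite -green_fix.
Qed.

(** The strong Markov property at the exit from A'.  If v is a supersolution for
    A', then min(v, w) is one for A: on A' the two equations agree, and off A'
    the boundary values give w <= v.  The minimality of w for A then yields
    w <= v. *)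
Lemma green_restrict (A A' : pred nat) b w : (forall y, 0 <= b y) ->
  (forall x, A' x -> A x) -> green A b w ->
  green A' (fun x => if A' x then b x else w x) w.
Proof.
move=> b0 AA g; have w0 y := green_ge0 y b0 g.
apply: green_of_supersol_min => //.
- by move=> y; case: ifP.
- move=> y; rewrite /kill; case: ifP => A'y; last by rewrite addr0.
  by rewrite [leRHS](green_fix _ g) /kill AA.
move=> v v0 hv x; suff : w x <= Num.min (v x) (w x) by rewrite le_min => /andP[].
apply: (@green_min A b w (fun z => Num.min (v z) (w z)) x g) => y.
  by rewrite le_min v0 w0.
have kmin z : kill A (fun z => Num.min (v z) (w z)) z <= kill A w z.
  by apply: le_kill => t; rewrite ge_min lexx orbT.
rewrite le_min; apply/andP; split; last first.
  by rewrite [leRHS](green_fix _ g) lerD2l.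
have := hv y; rewrite /kill; case: ifP => A'y.
  rewrite AA// => /(le_trans _); apply; rewrite lerD2l; apply: le_step => z.
  by rewrite ge_min lexx.
rewrite addr0 => /(le_trans _); apply.
by rewrite [leRHS](green_fix _ g) lerD2l; exact: kmin.
Qed.

Lemma iter_killD A f g n x :
  iter n (kill A) (fun y => f y + g y) x = iter n (kill A) f x + iter n (kill A) g x.
Proof. by elim: n x => [|n IH] x //=; rewrite -killD; apply: eq_kill. Qed.

Lemma iter_killZ A c f n x :
  iter n (kill A) (fun y => c * f y) x = c * iter n (kill A) f x.
Proof. by elim: n x => [|n IH] x //=; rewrite -killZ; apply: eq_kill. Qed.

Lemma greenD A b1 b2 w1 w2 : green A b1 w1 -> green A b2 w2 ->
  green A (fun x => b1 x + b2 x) (fun x => w1 x + w2 x).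
Proof.
move=> g1 g2 x; apply: (@eq_cvgn _ _ (fun n => psum A b1 n x + psum A b2 n x)).
  move=> n; rewrite /psum -[RHS]big_split/=.
  by apply: eq_bigr => r _; rewrite iter_killD.
by apply: cvgD; [apply: g1|apply: g2].
Qed.

Lemma greenZ A c b w : green A b w -> green A (fun x => c * b x) (fun x => c * w x).
Proof.
move=> g x; apply: (@eq_cvgn _ _ (fun n => c * psum A b n x)).
  move=> n; rewrite /psum mulr_sumr.
  by apply: eq_bigr => r _; rewrite iter_killZ.
by apply: cvgM; [exact: cvg_cst|exact: g].
Qed.

(** Used for boundary values that cannot be reached from A in one step. *)
Lemma green_const A b : (forall x, kill A b x = 0) -> green A b b.
Proof.
move=> k0 x.
have h m y : iter m.+1 (kill A) b y = 0.
  elim: m y => [|m IH] y; first exact: k0.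
  by rewrite iterS /kill (eq_step _ (IH : _ =1 fun=> 0)) step_cst if_same.
rewrite -cvg_shiftS/=; apply: (@eq_cvgn _ _ (fun=> b x)); last exact: cvg_cst.
by move=> n; rewrite /psum big_nat_recl//= big1 ?addr0// => r _; exact: h.
Qed.

(** In n steps the walk climbs at most n levels. *)
Lemma iter_kill_local (A A' : pred nat) b b' N n x :
  (forall y, (y <= N)%N -> A y = A' y) -> (forall y, (y <= N)%N -> b y = b' y) ->
  (x + n <= N)%N -> iter n (kill A) b x = iter n (kill A') b' x.
Proof.
move=> hA hb; elim: n x => [|n IH] x xN /=; first by apply: hb; lia.
rewrite /kill hA; last lia.
by case: ifP => // _; rewrite /step !IH//; lia.
Qed.

(** Squeezed between the partial sum of N - x terms, which only sees positions up
    to N, and w, a supersolution of each restricted problem. *)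
Lemma green_approx (A : pred nat) b w (AN : nat -> pred nat) bN wN :
  (forall y, 0 <= b y) -> green A b w ->
  (forall N y, 0 <= bN N y <= b y) ->
  (forall N y, AN N y -> A y) ->
  (forall N y, (y <= N)%N -> AN N y = A y /\ bN N y = b y) ->
  (forall N, green (AN N) (bN N) (wN N)) ->
  forall x, wN N x @[N --> \oo] --> w x.
Proof.
move=> b0 g hb hA hN gN x; have w0 y := green_ge0 y b0 g.
apply: (@squeeze_cvgr _ _ _ _ (fun N => psum A b (N - x)%N x) (fun=> w x)); last 2 first.
- by rewrite (@cvg_centern x _ (psum A b ^~ x)); exact: g.
- exact: cvg_cst.
exists x => // N /= xN; apply/andP; split.
  apply: le_trans (psum_le_green (N - x)%N x _ (gN N)); last by move=> y; have /andP[] := hb N y.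
  rewrite /psum !big_mkord; apply: ler_sum => r _.
  rewrite (@iter_kill_local A (AN N) b (bN N) N)//; last by have := ltn_ord r; lia.
    by move=> y /hN[].
  by move=> y /hN[].
apply: (@green_min _ _ _ w x (gN N)) => // y; rewrite [leRHS](green_fix _ g).
apply: lerD; first by have /andP[] := hb N y.
rewrite /kill; case: ifP => [/hA->//|_]; case: ifP => // _; exact: step_ge0.
Qed.

Lemma iter_kill_cvg0 A b w x : green A b w -> iter n (kill A) b x @[n --> \oo] --> (0 : R).
Proof. by move=> g; apply: (@cvg_series_cvg_0 _ _ (fun n => iter n (kill A) b x)); apply: cvgP (g x). Qed.

(** A finite expected exit time forces the exit: the mass still in A after n steps
    is the general term of a convergent series. *)
Lemma green_exit (A : pred nat) w : green A (ind A) w ->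
  green A (ind (predC A)) (fun=> 1).
Proof.
move=> g x.
have h n y : psum A (ind (predC A)) n y = 1 - iter n (kill A) (fun=> 1) y.
  elim: n y => [|n IH] y; first by rewrite psum0/= subrr.
  rewrite psumS (eq_kill _ IH) iterS /ind/=; have [Ay|Ay] := boolP (A y).
    rewrite !killT// (eq_step (g := fun y => 1 + (-1) * iter n (kill A) (fun=> 1) y)).
      by rewrite stepD stepZ step_cst add0r mulN1r.
    by move=> z; rewrite mulN1r.
  by rewrite !killF// addr0 subr0.
apply: (@eq_cvgn _ _ (fun n => 1 - iter n (kill A) (fun=> 1) x)).
  by move=> n; exact: h.
rewrite -[X in _ --> X]subr0.
apply: cvgB; first exact: cvg_cst.
rewrite -cvg_shiftS/=; apply: eq_cvgn (iter_kill_cvg0 x g) => n.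
by rewrite -iterS iterSr (iter_kill_eq _ _ (kill1 A)).
Qed.

(** The expectation of the first positive time T outside A, as the sum of the
    P(T > n); the starting point itself may lie outside A. *)
Lemma return_cvg (A : pred nat) w x : green A (ind A) w ->
  \sum_(0 <= n < N) step (iter n (kill A) (fun=> 1)) x @[N --> \oo] --> 1 + step w x.
Proof.
move=> g; rewrite -cvg_shiftS/=.
apply: (@eq_cvgn _ _ (fun N => 1 + step (psum A (ind A) N) x)).
  move=> N; rewrite big_nat_recl// step_cst -step_sum; congr (_ + _).
  apply: eq_step => y; apply: eq_bigr => n _.
  by rewrite iterSr; exact: (iter_kill_eq _ _ (kill1 A)).
apply: cvgD; first exact: cvg_cst.
by apply: step_cvg => y; exact: g.
Qed.

(** * Splitting at a level *)

Definition pot (A : pred nat) (b : nat -> R) (x : nat) : R :=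
  limn (psum A b ^~ x).

Lemma green_pot A b w : green A b w -> green A b (pot A b) /\ pot A b = w.
Proof.
move=> g; suff -> : pot A b = w by [].
by apply/funext => x; exact: (cvg_lim _ (g x)).
Qed.

Lemma green_off A b w x : green A b w -> ~~ A x -> w x = b x.
Proof. by move=> g Ax; rewrite (green_fix x g) killF// addr0. Qed.

Lemma exit_green (A B : pred nat) : (forall x, B x -> ~~ A x) ->
  [/\ green A (ind B) (pot A (ind B)), forall x, 0 <= pot A (ind B) x &
      forall x, pot A (ind B) x <= 1].
Proof.
move=> BA.
have h : forall y, ind B y + kill A (fun=> 1) y <= 1.
  move=> y; rewrite /ind; have [Ay|Ay] := boolP (A y).
    by rewrite killT// step_cst//; case: (boolP (B y)) => [/BA|]; rewrite ?Ay ?add0r.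
  by rewrite killF// addr0; case: (B y).
have [w [g w0 w1]] := green_exists (ind_ge0 B) (fun=> ler01) h.
by have [gp e] := green_pot g; rewrite e in gp *.
Qed.

(** Probabilities of leaving {i, i+1, ...} at i - 1, respectively at i - 2. *)
Definition down1 (i : nat) := pot (leq i) (ind (pred1 i.-1)).
Definition down2 (i : nat) := pot (leq i) (ind (pred1 i.-2)).

Lemma down1P i : (0 < i)%N ->
  [/\ green (leq i) (ind (pred1 i.-1)) (down1 i), forall x, 0 <= down1 i x &
      forall x, down1 i x <= 1].
Proof. by move=> i0; apply: exit_green => x /= /eqP ->; lia. Qed.

Lemma down2P i : (0 < i)%N ->
  [/\ green (leq i) (ind (pred1 i.-2)) (down2 i), forall x, 0 <= down2 i x &
      forall x, down2 i x <= 1].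
Proof. by move=> i0; apply: exit_green => x /= /eqP ->; lia. Qed.

Lemma green0 A : green A (fun=> 0) (fun=> 0).
Proof. by apply: green_const => // x; rewrite /kill step_cst// if_same. Qed.

(** Above level i the walk behaves as in {i+1, i+2, ...} until it drops to i or
    i - 1; the values further down ([rest]) are out of reach of a single step. *)
Lemma level_split (A : pred nat) i b w w' : (0 < i)%N ->
  (forall x, 0 <= b x) -> (forall x, (i < x)%N -> A x) -> green A b w ->
  green (leq i.+1) (fun x => if (i < x)%N then b x else 0) w' ->
  w i.+1 = w' i.+1 + down1 i.+1 i.+1 * w i + down2 i.+1 i.+1 * w i.-1.
Proof.
move=> i0 b0 hA g g'.
have [g1 _ _] := down1P (ltn0Sn i); have [g2 _ _] := down2P (ltn0Sn i).
pose rest x := if (x < i.-1)%N then w x else 0.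
have gr : green (leq i.+1) rest rest.
  apply: green_const => // x; rewrite /kill; case: ifP => // xi.
  rewrite /step /rest !ifF ?mulr0 ?addr0//; lia.
have := greenD (greenD (greenD g' (greenZ (c := w i) g1)) (greenZ (c := w i.-1) g2)) gr.
have e x : (if (i < x)%N then b x else 0) + w i * ind (pred1 i.+1.-1) x +
    w i.-1 * ind (pred1 i.+1.-2) x + rest x = if (i < x)%N then b x else w x.
  rewrite /ind /rest /=; have [xi|xi] := ltnP i x.
    by rewrite !gtn_eqF ?ifF ?mulr0 ?addr0//; lia.
  have [->|xi1] := eqVneq x i.
    by rewrite gtn_eqF ?ifF ?mulr0 ?mulr1 ?addr0 ?add0r//; lia.
  rewrite mulr0 add0r; have [->|xi2] := eqVneq x i.-1.
    by rewrite ltnn mulr1 add0r addr0.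
  by rewrite mulr0 !add0r ifT//; lia.
move/(eq_green e)/(green_unique (green_restrict b0 hA g))/(_ i.+1) => ->.
by rewrite /rest ifF ?addr0; [rewrite [w i * _]mulrC [w i.-1 * _]mulrC|lia].
Qed.

Lemma level_splitE (A : pred nat) i b w : (0 < i)%N ->
  (forall x, 0 <= b x) -> (forall x, (i < x)%N -> A x) -> green A b w ->
  (forall x, (i < x)%N -> b x = 0) ->
  w i.+1 = down1 i.+1 i.+1 * w i + down2 i.+1 i.+1 * w i.-1.
Proof.
move=> i0 b0 hA g bz.
rewrite (level_split i0 b0 hA g (w' := fun=> 0)) ?add0r//.
by apply: eq_green (green0 _) => x; case: ifP => // /bz.
Qed.

Lemma green_at_bottom A i b w : green A b w -> A i -> ~~ A i.-1 -> ~~ A i.-2 ->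
  w i = b i + (p i * w i.+1 + q1 i * b i.-1 + q2 i * b i.-2).
Proof.
move=> g Ai A1 A2; rewrite [LHS](green_fix i g) killT// /step.
by rewrite (green_off g A1) (green_off g A2).
Qed.

Lemma down1_rec i : (1 < i)%N ->
  down1 i i = q1 i + p i * (down1 i.+1 i.+1 * down1 i i + down2 i.+1 i.+1).
Proof.
move=> i1; have i0 : (0 < i)%N by lia.
have [g _ _] := down1P i0.
rewrite {1}(green_at_bottom g) //=; try lia.
rewrite (level_splitE i0 (ind_ge0 _) _ g); [|lia|]; last first.
  by move=> x xi; rewrite /ind/= gtn_eqF//; lia.
rewrite (green_off g (x := i.-1)); last lia.
rewrite /ind/=.
have [-> ->] : (i == i.-1) = false /\ (i.-2 == i.-1) = false by lia.
by rewrite eqxx /=; ring.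
Qed.

Lemma down2_rec i : (1 < i)%N ->
  down2 i i = q2 i + p i * (down1 i.+1 i.+1 * down2 i i).
Proof.
move=> i1; have i0 : (0 < i)%N by lia.
have [g _ _] := down2P i0.
rewrite {1}(green_at_bottom g) //=; try lia.
rewrite (level_splitE i0 (ind_ge0 _) _ g); [|lia|]; last first.
  by move=> x xi; rewrite /ind/= gtn_eqF//; lia.
rewrite (green_off g (x := i.-1)); last lia.
rewrite /ind/=.
have [-> ->] : (i == i.-2) = false /\ (i.-1 == i.-2) = false by lia.
by rewrite eqxx /=; ring.
Qed.
(** * Time above a level *)

Lemma green_sub (A A' : pred nat) b b' w : (forall x, 0 <= b' x <= b x) ->
  (forall x, A' x -> A x) -> green A b w -> green A' b' (pot A' b').
Proof.
move=> hb hA g.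
have b0 x : 0 <= b x by have /andP[/le_trans h /h] := hb x.
have b'0 x : 0 <= b' x by have /andP[] := hb x.
have w0 x := green_ge0 x b0 g.
have h y : b' y + kill A' w y <= w y.
  rewrite [leRHS](green_fix y g); apply: lerD; first by have /andP[] := hb y.
  rewrite /kill; case: ifP => [/hA ->//|_].
  by case: ifP => // _; exact: step_ge0.
have [u [gu _ _]] := green_exists b'0 w0 h.
by have [] := green_pot gu.
Qed.

Lemma le_ind (B C : pred nat) x : (B x -> C x) -> 0 <= ind B x <= ind C x.
Proof.
by rewrite ind_ge0/= /ind; case: (B x) => [->//|_]; case: (C x).
Qed.

(** A bound at one level gives a bound at the next one, because p > 0: the value at
    x is at least p x times the previous partial sum at x + 1. *)
Lemma green_leq1_of_bound C : (forall n, psum (leq 1) (ind (leq 1)) n 1 <= C) ->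
  green (leq 1) (ind (leq 1)) (pot (leq 1) (ind (leq 1))).
Proof.
move=> hC.
have bnd x : exists D, forall n, psum (leq 1) (ind (leq 1)) n x.+1 <= D.
  elim: x => [|x [D hD]]; first by exists C.
  exists (D / p x.+1) => n; have [p0 _ q10 q20 _] := par_ge0 x.+1.
  rewrite ler_pdivlMr// mulrC; apply: le_trans (hD n.+1).
  have ps0 y := psum_ge0 (leq 1) n y (ind_ge0 (leq 1)).
  rewrite psumS killT// /step.
  have := mulr_ge0 q10 (ps0 x.+1.-1); have := mulr_ge0 q20 (ps0 x.+1.-2).
  have := ind_ge0 (leq 1) x.+1; lra.
move=> [|x]; last first.
  have [D hD] := bnd x; apply: nondecreasing_is_cvgn; first exact/psum_nd/ind_ge0.
  by exists D => _ [n _ <-].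
apply: (cvgP 0); apply: (@eq_cvgn _ _ (fun=> 0)); last exact: cvg_cst.
by case=> [|n]; rewrite ?psum0// psumS killF// addr0.
Qed.

Hypothesis hrec : green (leq 1) (ind (leq 1)) (pot (leq 1) (ind (leq 1))).

Definition life (i : nat) := pot (leq i) (ind (leq i)).

Lemma lifeP i : (0 < i)%N -> green (leq i) (ind (leq i)) (life i).
Proof.
move=> i0; apply: green_sub hrec; last by move=> x; exact: leq_trans.
by move=> x; apply: le_ind; exact: leq_trans.
Qed.

Lemma life_ge0 i x : (0 < i)%N -> 0 <= life i x.
Proof. by move=> i0; exact: green_ge0 (ind_ge0 _) (lifeP i0). Qed.

(** The potential that is constantly 1, by [green_exit], split at level i. *)
Lemma down_sum i : (0 < i)%N -> down1 i.+1 i.+1 + down2 i.+1 i.+1 = 1.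
Proof.
move=> i0; have g := green_exit hrec.
have := level_splitE i0 (ind_ge0 _) _ g; rewrite !mulr1 => <- // x xi.
  exact: leq_trans xi.
by rewrite /ind/= (leq_ltn_trans _ xi).
Qed.

(** The probability that a visit to k is not followed by an excursion above k that
    comes back to k; 1 / den k is the mean number of visits before the walk
    falls below k. *)
Definition den (k : nat) := 1 - p k * down1 k.+1 k.+1.

Lemma den_gt0 k : (0 < k)%N -> 0 < den k.
Proof.
move=> k0; case: hpar => _ _ _ /(_ k k0)[_ _ /andP[p0 p1] _].
have [_ _ h1] := down1P (ltn0Sn k).
rewrite subr_gt0; apply: le_lt_trans p1.
by rewrite -[leRHS]mulr1 ler_wpM2l// ltW.
Qed.

Lemma den_le1 k : den k <= 1.
Proof.
have [_ h0 _] := down1P (ltn0Sn k); have [_ p0 _ _ _] := par_ge0 k.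
by rewrite lerBlDr lerDl mulr_ge0.
Qed.

(** For the walk from i until it falls below i: [reach i k] is the expected number
    of steps from k - 1 to k (1 for k = i, the start), and [visits i k] the
    expected number of visits to k. *)
Definition reach (i k : nat) := \prod_(i <= l < k) (p l / den l).
Definition visits (i k : nat) := reach i k / den k.

Lemma reach_ge0 i k : (0 < i)%N -> 0 <= reach i k.
Proof.
move=> i0; rewrite /reach big_seq; apply: prodr_ge0 => l.
rewrite mem_index_iota => /andP[il _].
have [_ ? _ _ _] := par_ge0 l; rewrite divr_ge0// ltW// den_gt0//.
exact: leq_trans il.
Qed.

Lemma reachnn i : reach i i = 1.
Proof. by rewrite /reach big_geq. Qed.

Lemma reachSr i k : (i <= k)%N -> reach i k.+1 = visits i k * p k.
Proof. by move=> ik; rewrite /reach big_nat_recr//= /visits /reach; ring. Qed.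

Lemma visits_ge0 i k : (0 < i)%N -> (i <= k)%N -> 0 <= visits i k.
Proof.
by move=> i0 ik; rewrite divr_ge0 ?reach_ge0// ltW// den_gt0//; lia.
Qed.

(** The expected time spent in {i, ..., N}.  It vanishes for i = N + 1, so the
    recursion over the levels has no remainder, and N can tend to infinity
    afterwards. *)
Definition life_upto (N i : nat) := pot (leq i) (ind (fun x => (i <= x <= N)%N)).

Lemma life_uptoP N i : (0 < i)%N ->
  green (leq i) (ind (fun x => (i <= x <= N)%N)) (life_upto N i).
Proof.
move=> i0; apply: green_sub hrec; last by move=> x; exact: leq_trans.
by move=> x; apply: le_ind => /andP[+ _]; exact: leq_trans.
Qed.

Lemma life_upto_rec N i : (0 < i)%N ->
  life_upto N i i * den i = (i <= N)%:R + p i * life_upto N i.+1 i.+1.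
Proof.
move=> i0; have g := life_uptoP (N := N) i0; have g' := life_uptoP (N := N) (ltn0Sn i).
have := green_at_bottom g (leqnn i).
rewrite (level_split i0 (ind_ge0 _) _ g (w' := life_upto N i.+1)); last first.
- by apply: eq_green g' => x; rewrite /ind; case: (ltnP i x) => // /ltnW ->.
- by move=> x /ltnW.
rewrite (green_off g (x := i.-1)); last lia.
rewrite /ind/= leqnn/=.
have [-> ->] : (i <= i.-1)%N = false /\ (i <= i.-2)%N = false by lia.
by rewrite /den/= => h; rewrite mulrBr mulr1 {1}h; [ring|lia|lia].
Qed.

Lemma life_upto_gt N i : (0 < i)%N -> (N < i)%N -> life_upto N i i = 0.
Proof.
move=> i0 Ni; have g := life_uptoP (N := N) i0.
have e x : (fun=> 0) x = ind (fun x => (i <= x <= N)%N) x.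
  by rewrite /ind; case: andP => // -[ix xN]; lia.
by rewrite (green_unique g (eq_green e (green0 _))).
Qed.

Lemma life_uptoE N i : (0 < i)%N ->
  life_upto N i i = \sum_(i <= k < N.+1) visits i k.
Proof.
move=> i0; move: {2}(N.+1 - i)%N (leqnn (N.+1 - i)) => m.
elim: m i i0 => [|m IH] i i0 hm.
  by rewrite big_geq ?life_upto_gt//; lia.
have [iN|iN] := leqP i N; last by rewrite big_geq ?life_upto_gt.
have d0 := den_gt0 i0; have /lt0r_neq0 dn := d0.
have := life_upto_rec N i0; rewrite iN (IH i.+1)//; last lia.
move/(canRL (mulfK dn)) => ->; rewrite [RHS]big_ltn//.
rewrite mulrDl /visits reachnn; congr (_ + _).
rewrite mulrAC mulr_sumr [LHS]big_nat [RHS]big_nat.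
apply: eq_bigr => k /andP[ik kN].
by rewrite [in RHS]/reach big_ltn// -/(reach _ _); ring.
Qed.

Lemma visits_cvg i : (0 < i)%N ->
  \sum_(i <= k < n) visits i k @[n --> \oo] --> life i i.
Proof.
move=> i0; rewrite -cvg_shiftS/=.
apply: (@eq_cvgn _ _ (fun N => life_upto N i i)).
  by move=> n; rewrite life_uptoE.
apply: (@green_approx (leq i) (ind (leq i)) (life i) (fun=> leq i)
   (fun N => ind (fun x => (i <= x <= N)%N)) (fun N => life_upto N i)) => //.
- exact: lifeP.
- by move=> N y; apply: le_ind => /andP[].
- by move=> N y yN; rewrite /ind yN andbT.
- by move=> N; exact: life_uptoP.
Qed.

(** * Hitting and return times *)

(** [climb n] is the expected time from n to n + 1; the recursion needs the two
    preceding values, and the one before [climb 0] is set to 0. *)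
Fixpoint climb_pair (n : nat) : R * R :=
  if n is k.+1 then
    let: (u, v) := climb_pair k in
    ((1 + (q1 n + q2 n) * u + q2 n * v) / p n, u)
  else (1, 0).
Definition climb (n : nat) : R := (climb_pair n).1.

Lemma climb1 : p 1%N * climb 1 = 1 + (q1 1%N + q2 1%N) * climb 0.
Proof.
have [/lt0r_neq0 p0 _ _ _ _] := par_ge0 1.
by rewrite /climb/= mulr0 addr0 mulr1; field.
Qed.

Lemma climbSS n : p n.+2 * climb n.+2 =
  1 + (q1 n.+2 + q2 n.+2) * climb n.+1 + q2 n.+2 * climb n.
Proof.
have [/lt0r_neq0 p0 _ _ _ _] := par_ge0 n.+2.
rewrite /climb [climb_pair n.+2]/= -/(climb_pair n.+1) mulrC.
rewrite (_ : climb_pair n.+1 = ((climb_pair n.+1).1, climb n)) /= ?divfK//.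
by rewrite /climb; case: (climb_pair n).
Qed.

Lemma climb_ge0 n : 0 <= climb n.
Proof.
suff : 0 <= (climb_pair n).1 /\ 0 <= (climb_pair n).2 by case.
elim: n => [|n]; first by rewrite /= ler01 lexx.
rewrite /=; case: (climb_pair n) => u v /= [u0 v0]; split=> //.
have [_ p0 q10 q20 _] := par_ge0 n.+1.
by rewrite divr_ge0// !addr_ge0 ?mulr_ge0// addr_ge0.
Qed.

(** If the drop of s at every y < x is [climb y], the equation s x = 1 + step s x
    says exactly that the drop at x is [climb x]. *)
Lemma climb_step (s : nat -> R) x :
  (forall y, (y < x)%N -> s y = climb y + s y.+1) ->
  1 + step s x = s x + p x * (climb x + s x.+1 - s x).
Proof.
have [_ _ _ _ h] := par_ge0 x; case: x h => [|[|x]] h hs.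
- by rewrite /step/=; case: hpar => -> -> -> _; rewrite /climb/=; ring.
- have e : q1 1 + q2 1 = 1 - p 1 by rewrite -h addrK.
  rewrite mulrBr mulrDr climb1 /step/= (hs 0%N)// -[s 1%N in RHS]mul1r -{2}h; ring.
- rewrite mulrBr mulrDr climbSS /step/= (hs x)// (hs x.+1)//.
  by rewrite -[s x.+2 in RHS]mul1r -{2}h; ring.
Qed.

Definition hit (i : nat) := pot (predC1 i) (ind (predC1 i)).

(** The supersolution v: below i the sum of the climbing times, above i the time to
    fall below i + 1, plus the time C to climb from i - 1, where the walk may
    have landed. *)
Lemma hitP i : green (predC1 i) (ind (predC1 i)) (hit i).
Proof.
pose C := \sum_(i.-1 <= k < i) climb k.
pose v x := if (x <= i)%N then \sum_(x <= k < i) climb k else life i.+1 x + C.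
have c0 a : 0 <= \sum_(a <= k < i) climb k by apply: sumr_ge0 => k _; exact: climb_ge0.
have v0 x : 0 <= v x.
  by rewrite /v; case: ifP => // _; rewrite addr_ge0 ?c0// life_ge0.
have vS x : (x < i)%N -> v x = climb x + v x.+1.
  by move=> xi; rewrite /v xi ltnW// big_ltn.
have vle x : (i.-1 <= x)%N -> v x <= life i.+1 x + C.
  move=> xi; rewrite /v; case: ifP => // xi'.
  have [->|->] : x = i \/ x = i.-1 by lia.
    by rewrite big_geq// addr_ge0 ?c0// life_ge0.
  by rewrite lerDr life_ge0.
have hv y : ind (predC1 i) y + kill (predC1 i) v y <= v y.
  rewrite /ind /=; have [->|yi] := eqVneq y i.
    by rewrite killF ?addr0//= eqxx.
  rewrite killT//=; have [yi'|yi'] := ltnP y i; last first.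
    have {yi yi'} iy : (i < y)%N by lia.
    rewrite [leRHS]/v leqNgt iy/= (green_fix y (lifeP (ltn0Sn i))) killT//.
    rewrite /ind/= iy -addrA lerD2l -[X in _ + X](step_cst C y) -stepD /step.
    have [_ ? ? ? _] := par_ge0 y.
    by rewrite !lerD// ler_wpM2l// vle//; lia.
  rewrite climb_step; last by move=> z zy; apply: vS; lia.
  by rewrite [v y in X in _ + X]vS// subrr mulr0 addr0.
have [w [g _ _]] := green_exists (ind_ge0 _) v0 hv.
by have [] := green_pot g.
Qed.

Arguments hitP : clear implicits.

Lemma hit_ge0 i x : 0 <= hit i x.
Proof. exact: green_ge0 (ind_ge0 _) (hitP i). Qed.

Lemma hit_self i : hit i i = 0.
Proof. by rewrite (green_off (x := i) (hitP i)) /ind//= eqxx. Qed.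

Lemma hit_step i x : x != i -> hit i x = 1 + step (hit i) x.
Proof. by move=> xi; rewrite [LHS](green_fix x (hitP i)) /ind/= killT/= xi. Qed.

Lemma hit_below i x : (x < i)%N -> hit i x = climb x + hit i x.+1.
Proof.
elim/ltn_ind: x => x IH xi; have [p0 _ _ _ _] := par_ge0 x.
have := hit_step (negbT (ltn_eqF xi)); rewrite climb_step; last first.
  by move=> y yx; apply: IH => //; lia.
rewrite -[X in X = _ -> _]addr0 => /addrI/esym/eqP.
by rewrite mulf_eq0 (gt_eqF p0)/= subr_eq0 => /eqP.
Qed.

Lemma hit_pred i : (0 < i)%N -> hit i i.-1 = climb i.-1.
Proof. by case: i => // i _; rewrite hit_below//= hit_self addr0. Qed.

Lemma hit_above i : (0 < i)%N ->
  hit i i.+1 = life i.+1 i.+1 + down2 i.+1 i.+1 * hit i i.-1.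
Proof.
move=> i0; rewrite (level_split i0 (ind_ge0 _) _ (hitP i) (w' := life i.+1)).
- by rewrite hit_self mulr0 addr0.
- by move=> x /= xi; rewrite gtn_eqF.
apply: eq_green (lifeP (ltn0Sn i)) => x; rewrite /ind/=.
by case: ltnP => // xi; rewrite gtn_eqF.
Qed.

Lemma hit0_above : hit 0 1 = life 1 1.
Proof.
have e : (predC1 0%N : pred nat) = leq 1 by apply/funext => -[].
by have := hitP 0; rewrite e => /green_unique/(_ (lifeP (ltn0Sn 0))) ->.
Qed.

(** The expected return time to i. *)
Definition ret (i : nat) : R := 1 + step (hit i) i.

Lemma ret_ge1 i : 1 <= ret i.
Proof. by rewrite lerDl step_ge0// => y; exact: hit_ge0. Qed.

Lemma ret0E : ret 0 = 1 + life 1 1.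
Proof.
rewrite /ret /step/= hit0_above; case: hpar => -> -> -> _.
by rewrite !mul0r !addr0 mul1r.
Qed.

(** A climb from i - 2 to i passes through i - 1, which is why its expected time
    splits as [climb (i - 2) + climb (i - 1)]. *)
Lemma retE i : (0 < i)%N -> ret i =
  p i * life i.+1 i.+1 + (q1 i + q2 i + p i * down2 i.+1 i.+1) * hit i i.-1
  + (if (1 < i)%N then q2 i * hit i.-1 i.-2 else 0) + 1.
Proof.
case: i => [//|[|i]] _; rewrite /ret /step hit_above//=; first by ring.
have -> : hit i.+2 i = climb i + hit i.+2 i.+1 by rewrite hit_below.
have -> : hit i.+1 i = climb i by rewrite (hit_pred (ltn0Sn i)).
ring.
Qed.

(** * Passages by type and the matrices N_k *)

(** gamma, alpha and beta; the last two in a form without the ratio that can be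
    0 / 0. *)
Definition twostep (k : nat) := p k * down2 k.+1 k.+1.
Definition direct (k : nat) := p k * q1 k.+1 / den k.+1.
Definition indirect (k : nat) := p k * twostep k.+1 / den k.+1.

Lemma den_neq0 k : (0 < k)%N -> den k != 0.
Proof. by move=> k0; rewrite gt_eqF// den_gt0. Qed.

Lemma twostep_ge0 k : 0 <= twostep k.
Proof.
have [_ ? _ _ _] := par_ge0 k; have [_ h _] := down2P (ltn0Sn k).
exact: mulr_ge0.
Qed.

Lemma down1_den i : (1 < i)%N -> down1 i i * den i = q1 i + twostep i.
Proof. by move=> i1; rewrite /den mulrBr mulr1 {1}down1_rec// /twostep; ring. Qed.

Lemma down2_den i : (1 < i)%N -> down2 i i * den i = q2 i.
Proof. by move=> i1; rewrite /den mulrBr mulr1 {1}down2_rec//; ring. Qed.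

Lemma twostepE k : (0 < k)%N -> twostep k = p k * q2 k.+1 / den k.+1.
Proof. by move=> k0; rewrite -down2_den// -mulrA mulfK ?den_neq0. Qed.

Lemma denE k : (0 < k)%N -> den k = q1 k + q2 k + twostep k.
Proof.
move=> k0; have [_ _ _ _ h] := par_ge0 k; have h2 := down_sum k0.
rewrite /den /twostep -{1}h (_ : down2 _ _ = 1 - down1 k.+1 k.+1); first by ring.
by rewrite -h2; ring.
Qed.

Lemma direct_indirect k : (0 < k)%N -> 1 - direct k - indirect k = den k.
Proof.
move=> k0; rewrite -addrA -opprD -mulrDl -mulrDr -down1_den//.
by rewrite mulrA mulfK ?den_neq0.
Qed.

(** If the ratio is 0 / 0, then the exit probability in front of it is 0 too, by
    [down1_den]. *)
Lemma split_down1 k t : (0 < k)%N -> 0 <= t -> t <= q1 k.+1 + twostep k.+1 ->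
  p k * down1 k.+1 k.+1 * (t / (q1 k.+1 + twostep k.+1)) = p k * t / den k.+1.
Proof.
move=> k0 t0 tle; have d0 := den_neq0 (ltn0Sn k).
have := down1_den (k0 : (1 < k.+1)%N); set s := q1 _ + _ in tle *.
have [s0 _|s0 /(canRL (mulfK d0))->] := eqVneq s 0; last by field; apply/andP.
have -> : t = 0 by apply/eqP; rewrite eq_le t0 -s0 tle.
by rewrite mul0r !mulr0 mul0r.
Qed.

Definition types (k : nat) : 'rV[R]_3 :=
  mx_of_rows 1 3 [:: [:: q1 k; twostep k; q2 k]].

Definition offspring (k : nat) : 'M[R]_3 :=
  let a := direct k / den k in
  let b := indirect k / den k in
  mx_of_rows 3 3 [:: [:: a; b; 0]; [:: a; b; 1]; [:: a; b; 0]].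

(** Between two consecutive visits to k the walk makes an excursion above k that
    ends by a step from k + 1 or by a jump from k + 2; a passage of the second
    type at k is a passage of the third type at k + 1. *)
Lemma types_offspring i k : (0 < i)%N -> (i <= k)%N ->
  (visits i k *: types k) *m offspring k = visits i k.+1 *: types k.+1.
Proof.
move=> i0 ik; have k0 : (0 < k)%N by lia.
have d0 := den_neq0 k0; have d1 := den_neq0 (ltn0Sn k).
apply/rowP => j; rewrite /types /offspring !mxE !big_ord_recl big_ord0 !mxE/=.
have -> : visits i k.+1 = visits i k * p k / den k.+1 by rewrite -reachSr.
have e : twostep k = den k - q1 k - q2 k by rewrite denE//; ring.
case: j => [[|[|[|//]]] hj] /=; rewrite /direct /indirect.
- by rewrite e; field; apply/andP.
- by rewrite e; field; apply/andP.
- by rewrite [twostep k]twostepE//; field.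
Qed.

Definition lineage (i k : nat) : 'M[R]_3 := \prod_(i <= l < k.+1) offspring l.

Lemma lineagenn i : lineage i i = offspring i.
Proof. by rewrite /lineage big_nat1. Qed.

Lemma lineageSr i k : (i <= k)%N -> lineage i k.+1 = lineage i k *m offspring k.+1.
Proof. by move=> ik; rewrite /lineage big_nat_recr//=; lia. Qed.

Lemma lineageSl i k : (i < k)%N -> lineage i k = offspring i *m lineage i.+1 k.
Proof. by move=> ik; rewrite /lineage big_ltn//; lia. Qed.

Lemma visitsnn i : visits i i = (den i)^-1.
Proof. by rewrite /visits reachnn mul1r. Qed.

Lemma types_lineage i k : (0 < i)%N -> (i <= k)%N ->
  ((den i)^-1 *: types i) *m lineage i k = visits i k.+1 *: types k.+1.
Proof.
move=> i0 /subnKC <-; elim: (k - i)%N => [|n IH].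
  by rewrite addn0 lineagenn -visitsnn types_offspring.
rewrite addnS lineageSr ?leq_addr// mulmxA IH types_offspring//.
by rewrite (leq_trans (leq_addr n i)).
Qed.

Lemma direct_ge0 k : 0 <= direct k.
Proof.
have [_ ? _ _ _] := par_ge0 k; have [_ _ ? _ _] := par_ge0 k.+1.
by apply: divr_ge0; [exact: mulr_ge0|exact/ltW/den_gt0].
Qed.

Lemma indirect_ge0 k : 0 <= indirect k.
Proof.
have [_ ? _ _ _] := par_ge0 k.
by apply: divr_ge0; [exact/mulr_ge0/twostep_ge0|exact/ltW/den_gt0].
Qed.

Lemma offspring_ge0 k a b : (0 < k)%N -> 0 <= offspring k a b.
Proof.
move=> k0; have d0 := ltW (den_gt0 k0).
have h1 := divr_ge0 (direct_ge0 k) d0; have h2 := divr_ge0 (indirect_ge0 k) d0.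
by rewrite mxE; case: a b => [[|[|[|//]]] ha] [[|[|[|//]]] hb].
Qed.

Lemma mulmx_ge0 m n o (A : 'M[R]_(m, n)) (B : 'M[R]_(n, o)) a b :
  (forall c, 0 <= A a c) -> (forall c, 0 <= B c b) -> 0 <= (A *m B) a b.
Proof. by move=> A0 B0; rewrite mxE sumr_ge0// => c _; exact: mulr_ge0. Qed.

Lemma lineage_ge0 i k a b : (0 < i)%N -> (i <= k)%N -> 0 <= lineage i k a b.
Proof.
move=> i0 /subnKC <-; elim: (k - i)%N a b => [|n IH] a b.
  by rewrite addn0 lineagenn offspring_ge0.
rewrite addnS lineageSr ?leq_addr// mulmx_ge0// => c.
exact: offspring_ge0.
Qed.

Lemma le_types k b : (0 < k)%N -> types k 0 b <= den k.
Proof.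
move=> k0; have [_ _ h1 h2 _] := par_ge0 k; have h3 := twostep_ge0 k.
rewrite denE// mxE; case: b => [[|[|[|//]]] hb] /=; lra.
Qed.

Lemma visits_types i k b : (0 < i)%N -> (i <= k)%N ->
  (visits i k.+1 *: types k.+1) 0 b <= visits i k.
Proof.
move=> i0 ik; rewrite mxE; apply: (@le_trans _ _ (visits i k * p k)).
  rewrite -reachSr// /visits -mulrA ler_piMr ?reach_ge0//.
  by rewrite mulrC ler_pdivrMr ?den_gt0// mul1r le_types.
rewrite ler_piMr ?visits_ge0//; have [_ _ ? ? <-] := par_ge0 k.
by rewrite lerDr addr_ge0.
Qed.

(** A passage of the first type has the offspring of the walk started at i, except
    that the last excursion of this walk may add a passage of the third type. *)
Lemma lineage_row0 i k b : (0 < i)%N -> (i <= k)%N ->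
  lineage i k 0 b <= (visits i k.+1 *: types k.+1) 0 b.
Proof.
move=> i0 /subnKC <-; elim: (k - i)%N b => [|n IH] b.
  have d0 := den_neq0 i0; have d1 := den_neq0 (ltn0Sn i).
  have e : visits i i.+1 = (den i)^-1 * p i / den i.+1.
    by rewrite -visitsnn -reachSr.
  rewrite addn0 lineagenn !mxE.
  case: b => [[|[|[|//]]] hb] /=; last first.
  - by rewrite mulr_ge0 ?visits_ge0//; have [_ _ _ ? _] := par_ge0 i.+1.
  - by rewrite e /indirect le_eqVlt; apply/orP; left; apply/eqP; field; apply/andP.
  - by rewrite e /direct le_eqVlt; apply/orP; left; apply/eqP; field; apply/andP.
have ik : (i <= i + n)%N by rewrite leq_addr.
rewrite addnS lineageSr// -types_offspring; [|exact: i0|lia].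
rewrite [leLHS]mxE [leRHS]mxE; apply: ler_sum => c _.
by rewrite ler_wpM2r// offspring_ge0.
Qed.

Lemma lineage_row2 i k b : (0 < i)%N -> (i <= k)%N -> lineage i k 2 b = lineage i k 0 b.
Proof.
move=> i0; rewrite leq_eqVlt => /predU1P[<-|ik].
  by rewrite lineagenn !mxE; case: b => [[|[|[|//]]] hb].
by rewrite lineageSl// !mxE; apply: eq_bigr => c _; congr (_ * _); rewrite !mxE.
Qed.

(** Passages of the second type differ from the others only by the jump that ends
    them, of the third type one level higher. *)
Lemma lineage_row1 i k b : (0 < i)%N -> (i < k)%N ->
  lineage i k 1 b = lineage i k 0 b + lineage i.+1 k 2 b.
Proof.
move=> i0 ik; rewrite lineageSl// [LHS]mxE [X in X + _]mxE !big_ord_recl !big_ord0 !mxE/=.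
have -> : lift ord0 (lift ord0 ord0) = 2 :> 'I_3 by apply/val_inj.
ring.
Qed.

Lemma lineage_bound i k a b : (0 < i)%N -> (i < k)%N ->
  lineage i k a b <= visits i k + visits i.+1 k.
Proof.
move=> i0 ik; have ik' := ltnW ik.
have h0 j c : (0 < j)%N -> (j <= k)%N -> lineage j k 0 c <= visits j k.
  by move=> j0 jk; apply: le_trans (visits_types _ j0 jk); exact: lineage_row0.
have v0 : 0 <= visits i.+1 k by exact: visits_ge0.
have := h0 i b i0 ik'; have := h0 i.+1 b isT ik; have := lineage_row1 b i0 ik.
have := lineage_row2 b i0 ik'; have := lineage_row2 b (ltn0Sn i) ik.
case: a => [[|[|[|//]]] ha].
- by rewrite (_ : Ordinal ha = 0); [lra|exact/val_inj].
- by rewrite (_ : Ordinal ha = 1); [lra|exact/val_inj].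
- by rewrite (_ : Ordinal ha = 2); [lra|exact/val_inj].
Qed.

Lemma sum_visits_le i n : (0 < i)%N -> \sum_(i <= k < n) visits i k <= life i i.
Proof.
move=> i0.
have nd : nondecreasing_seq (fun n => \sum_(i <= k < n) visits i k).
  apply/nondecreasing_seqP => m; have [mi|im] := ltnP m i.
    by rewrite !big_geq//; lia.
  by rewrite [leRHS]big_nat_recr//= lerDl visits_ge0.
have := nondecreasing_cvgn_le nd (cvgP _ (visits_cvg i0)) n.
by rewrite (cvg_lim (@Rhausdorff R) (visits_cvg i0)).
Qed.

Definition progeny (i n : nat) : 'M[R]_3 := \sum_(i <= k < n) lineage i k.

Lemma progeny_entry_cvg i a b : (0 < i)%N -> cvgn (fun n => progeny i n a b).
Proof.
move=> i0; apply: nondecreasing_is_cvgn.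
  apply/nondecreasing_seqP => n; have [ni|ni] := ltnP n i.
    by rewrite /progeny !big_geq//; lia.
  by rewrite /progeny [in leRHS]big_nat_recr//= [leRHS]mxE lerDl lineage_ge0.
exists (lineage i i a b + life i i + life i.+1 i.+1) => _ [n _ <-].
have l0 j : (0 < j)%N -> 0 <= life j j by exact: life_ge0.
rewrite /progeny summxE; have [ni|ni] := leqP n i.
  by rewrite big_geq// !addr_ge0 ?l0// lineage_ge0.
rewrite big_ltn// -addrA lerD2l.
apply: (@le_trans _ _ (\sum_(i.+1 <= k < n) (visits i k + visits i.+1 k))).
  rewrite big_nat [leRHS]big_nat; apply: ler_sum => k /andP[ik _].
  exact: lineage_bound.
rewrite big_split/= lerD ?sum_visits_le//.
apply: le_trans (sum_visits_le n i0); rewrite [leRHS]big_ltn// lerDr.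
exact: visits_ge0.
Qed.

Lemma reach_cvg0 i : (0 < i)%N -> reach i n @[n --> \oo] --> (0 : R).
Proof.
move=> i0; apply: (@squeeze_cvgr _ _ _ _ (fun=> 0)
  (fun n => \sum_(i <= k < n.+1) visits i k - \sum_(i <= k < n) visits i k)).
- exists i => // n /= ni; rewrite reach_ge0//= big_nat_recr//= [X in X - _]addrC addrK.
  rewrite /visits ler_peMr ?reach_ge0// invf_ge1 ?den_le1 ?den_gt0//; lia.
- exact: cvg_cst.
have c := visits_cvg i0; have c' := c; rewrite -cvg_shiftS in c'.
have h := cvgB c' c; rewrite subrr in h; exact: h.
Qed.

(** A passage at level k > i is worth two steps, the one from k - 1 to k and the one
    down.  A jump from k + 1 to k - 1 is a passage of the second type at k and of
    the third type at k + 1, and is worth 2 + 1 with the two steps up.  What the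
    cut at n misses is [reach i n]. *)
Lemma weigh_types i n : (0 < i)%N -> (i <= n)%N ->
  1 + dot (mx_of_rows 1 3 [:: [:: 2; 2; 1]]) (((den i)^-1 *: types i) *m progeny i n)
  = \sum_(i <= k < n) visits i k + reach i n.
Proof.
move=> i0 /subnKC <-; elim: (n - i)%N => [|m IH].
  rewrite addn0 /progeny !big_geq// mulmx0 reachnn add0r.
  by rewrite /dot trmx0 mulmx0 mxE addr0.
have im : (i <= i + m)%N := leq_addr m i.
have k0 : (0 < i + m)%N by lia.
rewrite addnS /progeny !big_nat_recr//= mulmxDr types_lineage// /dot linearD/= mulmxDr.
rewrite mxE addrA [1 + _]IH reachSr// -!addrA; congr (_ + _).
rewrite !mxE !big_ord_recl !big_ord0 !mxE/=.
have -> : visits i (i + m).+1 = visits i (i + m) * p (i + m)%N / den (i + m).+1 by rewrite -reachSr.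
have e : twostep (i + m)%N = p (i + m)%N * q2 (i + m).+1 / den (i + m).+1 by exact: twostepE.
have -> : reach i (i + m) = visits i (i + m) * den (i + m) by rewrite divfK ?den_neq0.
have d1 := den_neq0 (ltn0Sn (i + m)).
have -> : twostep (i + m).+1 = den (i + m).+1 - q1 (i + m).+1 - q2 (i + m).+1.
  by rewrite denE//; ring.
have h : q1 (i + m)%N = 1 - q2 (i + m)%N - p (i + m)%N.
  by have [_ _ _ _ <-] := par_ge0 (i + m)%N; ring.
rewrite (denE k0) e h; field.
exact: d1.
Qed.

Lemma life_progeny i (L : 'M[R]_3) : (0 < i)%N ->
  (forall a b, progeny i n a b @[n --> \oo] --> L a b) ->
  life i i = 1 + dot (mx_of_rows 1 3 [:: [:: 2; 2; 1]]) (((den i)^-1 *: types i) *m L).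
Proof.
move=> i0 hL; set w := mx_of_rows _ _ _; set u := _ *: _.
have c1 : 1 + dot w (u *m progeny i n) @[n --> \oo] --> life i i.
  have h := cvgD (visits_cvg i0) (reach_cvg0 i0); rewrite addr0 in h.
  apply: (@eventually_eq_cvgn _ i _ (fun n => \sum_(i <= k < n) visits i k + reach i n)).
    by move=> n; exact: weigh_types.
  exact: h.
apply: (cvgn_unique c1); apply: cvgD; first exact: cvg_cst.
have dotE v : dot w v = \sum_(j < 3) w 0 j * v 0 j.
  by rewrite /dot mxE; apply: eq_bigr => j _; rewrite !mxE.
rewrite dotE; apply: (@eq_cvgn _ _ (fun n => \sum_(j < 3) w 0 j * \sum_k u 0 k * progeny i n k j)).
  by move=> n; rewrite dotE; apply: eq_bigr => j _; rewrite [(u *m _) _ _]mxE.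
rewrite (eq_bigr (fun j => w 0 j * \sum_k u 0 k * L k j)); last first.
  by move=> j _; rewrite [(u *m _) _ _]mxE.
apply: cvgn_sum => j; apply: cvgM; first exact: cvg_cst.
apply: cvgn_sum => k; apply: cvgM; first exact: cvg_cst.
exact: hL.
Qed.

(** * Stationary distributions *)

Local Notation Q := (walk_trans p q1 q2).

Lemma transE i j : Q i j =
  p i * (j == i.+1)%:R + q1 i * (j == i.-1)%:R + q2 i * (j == i.-2)%:R.
Proof.
case: hpar => p0 q10 q20 _; case: i => [|[|i]] /=.
- by rewrite q10 q20 !mul0r !addr0 p0 mul1r; case: (j == 1%N).
- case: (eqVneq j 2%N) => [->|_] /=; first by rewrite !mulr0 !addr0 mulr1.
  by case: (j == 0%N); rewrite ?mulr0 ?mulr1 !add0r// addr0.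
- case: (eqVneq j i.+3) => [->|_].
    by rewrite !gtn_eqF ?mulr1 ?mulr0 ?addr0//; lia.
  case: (eqVneq j i.+1) => [->|_].
    by rewrite gtn_eqF// mulr1 !mulr0 addr0 add0r.
  by case: (j == i); rewrite ?mulr0 ?mulr1 ?addr0 ?add0r.
Qed.

Lemma trans_ge0 i j : 0 <= Q i j.
Proof.
have [_ ? ? ? _] := par_ge0 i.
by rewrite transE !addr_ge0 ?mulr_ge0 ?ler0n.
Qed.

Lemma cvg_row_sum i g : \sum_(0 <= j < n) Q i j * g j @[n --> \oo] --> step g i.
Proof.
apply: (@eq_cvgn _ _ (fun n =>
   p i * (\sum_(0 <= j < n) (j == i.+1)%:R * g j) +
   q1 i * (\sum_(0 <= j < n) (j == i.-1)%:R * g j) +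
   q2 i * (\sum_(0 <= j < n) (j == i.-2)%:R * g j))).
  move=> n; rewrite !mulr_sumr -!big_split; apply: eq_bigr => j _ /=.
  rewrite transE; ring.
by apply: cvgD; [apply: cvgD|]; (apply: cvgM; [exact: cvg_cst|exact: cvg_sum_point]).
Qed.

Lemma row_sum i g : (\sum_(0 <= j <oo) (Q i j * g j)%:E = (step g i)%:E)%E.
Proof. exact: (@eseries_EFin _ (fun j => Q i j * g j) _ (@cvg_row_sum i g)). Qed.

(** Exchange of the sums over the current and the next position. *)
Lemma stationary_step mu g : stationary Q mu -> (forall x, 0 <= g x) ->
  (\sum_(0 <= k <oo) (mu k * step g k)%:E = \sum_(0 <= j <oo) (mu j * g j)%:E)%E.
Proof.
move=> [mu0 _ hmu] g0.
transitivity (\sum_(0 <= k <oo) \sum_(0 <= j <oo) (mu k * Q k j * g j)%:E)%E.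
  apply: eq_eseriesr => k _; rewrite EFinM -row_sum -nneseriesZl; last first.
    by move=> j _; rewrite lee_fin mulr_ge0// trans_ge0.
  by apply: eq_eseriesr => j _; rewrite -EFinM mulrA.
rewrite nneseries_interchange; last first.
  by move=> k j; rewrite lee_fin !mulr_ge0// trans_ge0.
apply: eq_eseriesr => j _; rewrite mulrC EFinM -hmu -nneseriesZl; last first.
  by move=> k _; rewrite lee_fin mulr_ge0// trans_ge0.
by apply: eq_eseriesr => k _; rewrite -EFinM mulrC.
Qed.

Section Kac.
Variables (mu : nat -> R) (i : nat).
Hypothesis hmu : stationary Q mu.

Let mu0 k : 0 <= mu k. Proof. by case: hmu. Qed.

Let surv n := iter n (kill (predC1 i)) (fun=> 1).

Lemma surv_ge0 n x : 0 <= surv n x.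
Proof. exact: iter_kill_ge0. Qed.

Lemma surv_le1 n x : surv n x <= 1.
Proof.
elim: n x => [|n IH] x //=; rewrite -[leRHS](step_cst 1 x) /kill; case: ifP => _.
  exact: le_step.
by rewrite step_cst.
Qed.

(** [surv N] is the probability of no visit to i at times 0, ..., N - 1.  By
    stationarity, applying Q does not change the mu-mass of [surv N]; removing
    the point i then costs the mu(i)-part of it. *)
Lemma surv_mass N :
  (\sum_(0 <= k <oo) (mu k * surv N k)%:E
   + (mu i * \sum_(0 <= n < N) step (surv n) i)%:E = 1)%E.
Proof.
elim: N => [|N IH].
  rewrite big_geq// mulr0 adde0; case: hmu => _ <- _.
  by apply: eq_eseriesr => k _; rewrite mulr1.
rewrite big_nat_recr//= mulrDr [(mu i * _ + _)%R]addrC EFinD addeA -[RHS]IH.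
congr (_ + _)%E; rewrite -stationary_step//; last exact: surv_ge0.
rewrite -(eseries_EFin (@cvg_sum_point _ (fun k => mu k * step (surv N) k) i)).
rewrite -nneseriesD.
- apply: eq_eseriesr => k _; rewrite -EFinD; congr (_%:E).
  have [->|ki] := eqVneq k i; first by rewrite killF/= ?eqxx// mulr0 add0r mul1r.
  by rewrite killT//= mul0r addr0.
- by move=> k _ _; rewrite lee_fin mulr_ge0// kill_ge0// => ?; exact: surv_ge0.
- by move=> k _ _; rewrite lee_fin !mulr_ge0 ?ler0n ?step_ge0// => ?; exact: surv_ge0.
Qed.

Lemma surv_cvg0 x : surv n x @[n --> \oo] --> (0 : R).
Proof.
rewrite -cvg_shiftS/=; apply: eq_cvgn (iter_kill_cvg0 x (hitP i)) => n.
rewrite -[LHS]/(iter n.+1 (kill (predC1 i)) (fun=> 1) x) iterSr.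
exact: (iter_kill_eq _ _ (kill1 _)).
Qed.

Lemma ret_cvg : \sum_(0 <= n < N) step (surv n) i @[N --> \oo] --> ret i.
Proof. exact: return_cvg (hitP i). Qed.

(** The limit of [surv_mass], in which the surviving mass disappears.  It is enough
    to test this on finitely many starting points, mu being a probability. *)
Lemma kac : mu i * ret i = 1.
Proof.
have cM : mu i * (\sum_(0 <= n < N) step (surv n) i) @[N --> \oo] --> mu i * ret i.
  by apply: cvgM; [exact: cvg_cst|exact: ret_cvg].
apply/eqP; rewrite eq_le; apply/andP; split.
  apply: cvgr_to_le cM _; apply: nearW => N.
  rewrite -lee_fin -[leRHS](surv_mass N) leeDr//.
  by apply: nneseries_ge0 => k _ _; rewrite lee_fin mulr_ge0// surv_ge0.
have c1 : \sum_(0 <= k < K) mu k @[K --> \oo] --> (1 : R).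
  by apply: eseries_EFin_cvg => //; case: hmu.
apply: cvgr_to_le c1 _; apply: nearW => K.
have cK : \sum_(k < K) mu k * (1 - surv N k) @[N --> \oo] --> \sum_(k < K) mu k * (1 - 0).
  apply: cvgn_sum => k; apply: cvgM; first exact: cvg_cst.
  by apply: cvgB; [exact: cvg_cst|exact: surv_cvg0].
rewrite big_mkord (_ : \sum_(k < K) mu k = \sum_(k < K) mu k * (1 - 0)); last first.
  by apply: eq_bigr => k _; rewrite subr0 mulr1.
apply: ler_cvg_to cK cM _; apply: nearW => N.
have hs k : 0 <= mu k * (1 - surv N k) by rewrite mulr_ge0// subr_ge0 surv_le1.
have h : (\sum_(0 <= k <oo) (mu k * (1 - surv N k))%:E
          = (mu i * \sum_(0 <= n < N) step (surv n) i)%:E)%E.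
  have e : (\sum_(0 <= k <oo) (mu k * surv N k)%:E
     + \sum_(0 <= k <oo) (mu k * (1 - surv N k))%:E = 1)%E.
    rewrite -nneseriesD//; last 2 first.
    - by move=> k _ _; rewrite lee_fin mulr_ge0// surv_ge0.
    - by move=> k _ _; rewrite lee_fin.
    case: hmu => _ <- _; apply: eq_eseriesr => k _; rewrite -EFinD; congr (_%:E); ring.
  move: e (surv_mass N); case: (limn _) => [s| |] //; case: (limn _) => [t| |] //.
  by rewrite -!EFinD => -[<-] [/addrI->].
rewrite -lee_fin -h -(big_mkord xpredT (fun k => mu k * (1 - surv N k))) -sumEFin.
apply: nneseries_lim_ge => k _ _; rewrite lee_fin; exact: hs.
Qed.

End Kac.
(** The expected number of visits to j during an excursion from 0. *)
Definition occupation (j : nat) : R := if j is 0 then 1 else visits 1 j.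

Lemma occupation_ge0 j : 0 <= occupation j.
Proof. by case: j => [|j]; rewrite /occupation ?ler01// visits_ge0. Qed.

Lemma occupation_cvg : \sum_(0 <= j < n) occupation j @[n --> \oo] --> ret 0.
Proof.
rewrite ret0E -cvg_shiftS/=.
apply: (@eq_cvgn _ _ (fun n => 1 + \sum_(1 <= j < n.+1) visits 1 j)).
  by move=> n; rewrite big_nat_recl// big_add1.
apply: cvgD; first exact: cvg_cst.
by have := visits_cvg (ltn0Sn 0); rewrite -cvg_shiftS.
Qed.

Lemma visits_up j : visits 1 j.+1 * den j.+1 = p j * occupation j.
Proof.
rewrite divfK ?den_neq0//; case: j => [|j]; last by rewrite reachSr// mulrC.
by rewrite reachnn /=; case: hpar => -> _ _ _; rewrite mulr1.
Qed.

(** Jumps from j + 2 to j are the ends of the excursions above j + 1 that skip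
    j + 1. *)
Lemma visits_down2 j : visits 1 j.+2 * q2 j.+2 = visits 1 j.+1 * twostep j.+1.
Proof.
rewrite twostepE// -[visits 1 j.+2](mulfK (den_neq0 (ltn0Sn j.+1))) visits_up /=.
ring.
Qed.

(** Balance of flows: with the inflow from above expressed by [visits_down2], it
    reduces to den = q1 + q2 + twostep at two consecutive levels. *)
Lemma occupation_invariant j :
  \sum_(0 <= i < n) occupation i * Q i j @[n --> \oo] --> occupation j.
Proof.
have far i : (j.+3 <= i)%N -> occupation i * Q i j = 0.
  by move=> ij; rewrite transE !ltn_eqF ?mulr0 ?addr0 ?mulr0//; lia.
suff <- : \sum_(0 <= i < j.+3) occupation i * Q i j = occupation j.
  exact: cvg_sum_finsupp far.
case: j {far} => [|j].
  rewrite !big_nat_recr//= big_geq//= mulr0 !add0r visits_down2.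
  have := visits_up 0; rewrite mulr1 denE//; case: hpar => -> _ _ _ <-; ring.
rewrite !big_nat_recr//; rewrite big_nat big1 => [|i /andP[_ ij]]; last first.
  by rewrite transE !gtn_eqF ?mulr0 ?addr0 ?mulr0//; lia.
rewrite !transE /=.
have -> : (j.+1 == j.-1) = false by lia.
have -> : (j.+1 == j.-2) = false by lia.
have -> : (j.+1 == j.+2) = false by lia.
have -> : (j.+1 == j) = false by lia.
have -> : (j.+1 == j.+3) = false by lia.
have -> : (j.+1 == j.+4) = false by lia.
rewrite eqxx /=.
have h1 := visits_up j; have h2 := visits_up j.+1; have h3 := visits_down2 j.
have h4 := visits_down2 j.+1.
have e1 := congr1 ( *%R (visits 1 j.+1)) (denE (ltn0Sn j)).
have e2 := congr1 ( *%R (visits 1 j.+2)) (denE (ltn0Sn j.+1)).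
have e3 : visits 1 j.+1 * (q1 j.+1 + q2 j.+1 + p j.+1) = visits 1 j.+1.
  by have [_ _ _ _ ->] := par_ge0 j.+1; rewrite mulr1.
rewrite /occupation in h1 h2 *; lra.
Qed.

Lemma stationary_occupation : stationary Q (fun j => occupation j / ret 0).
Proof.
have r0 : 0 < ret 0 by apply: lt_le_trans (ret_ge1 0).
split => [j||j].
- by rewrite divr_ge0 ?occupation_ge0// ltW.
- apply: eseries_EFin; rewrite -[X in _ --> X](divff (lt0r_neq0 r0)).
  apply: (@eq_cvgn _ _ (fun n => (\sum_(0 <= j < n) occupation j) * (ret 0)^-1)).
    by move=> n; rewrite mulr_suml.
  by apply: cvgM; [exact: occupation_cvg|exact: cvg_cst].
- apply: eseries_EFin.
  apply: (@eq_cvgn _ _ (fun n => (\sum_(0 <= i < n) occupation i * Q i j) * (ret 0)^-1)).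
    by move=> n; rewrite mulr_suml; apply: eq_bigr => i _; rewrite mulrAC.
  by apply: cvgM; [exact: occupation_invariant|exact: cvg_cst].
Qed.

Lemma stationaryE mu : stationary Q mu -> mu = fun i => (ret i)^-1.
Proof.
move=> hmu; apply/funext => i.
have r0 : ret i != 0 by rewrite gt_eqF// (lt_le_trans _ (ret_ge1 i)).
by apply: (mulIf r0); rewrite mulVf// kac.
Qed.

Lemma stationary_ret : stationary Q (fun i => (ret i)^-1).
Proof. by rewrite -(stationaryE stationary_occupation); exact: stationary_occupation. Qed.

(** * Climbing times and exits from a window as matrix products *)

Lemma desc_prodS n (A : nat -> 'M[R]_n.+1) k m :
  desc_prod A k.+1 m.+1 = A k.+1 *m desc_prod A k m.
Proof. by rewrite /desc_prod big_nat_recl// subn0. Qed.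

Lemma desc_prod1 n (A : nat -> 'M[R]_n.+1) k : desc_prod A k 1 = A k.
Proof. by rewrite /desc_prod big_nat1 subn0. Qed.

Lemma climb_matrix i : climb i = 1 + \sum_(1 <= k < i.+1)
  ((delta_mx 0 0 : 'rV[R]_2) *m desc_prod (Mmx p q1 q2) i k
     *m (mx_of_rows 1 2 [:: [:: 2; 1]])^T) 0 0.
Proof.
set c := _^T; pose s i : 'cV[R]_2 := \sum_(1 <= k < i.+1) desc_prod (Mmx p q1 q2) i k *m c.
have sS j : s j.+1 = Mmx p q1 q2 j.+1 *m (c + s j).
  rewrite /s big_ltn// desc_prod1 mulmxDr; congr (_ + _).
  rewrite mulmx_sumr big_add1; apply: eq_bigr => k _.
  by rewrite desc_prodS mulmxA.
(* the second coordinate is the expected time from j - 1 to j + 1 *)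
have hs j : s j 0 0 = climb j - 1 /\ ((0 < j)%N -> s j 1 0 = climb j + climb j.-1).
  elim: j => [|j [IH0 IH1]].
    by rewrite /s big_geq// !mxE subrr.
  have [/lt0r_neq0 p0 _ _ _ h] := par_ge0 j.+1.
  suff [e0 e1] : s j.+1 0 0 = climb j.+1 - 1 /\ s j.+1 1 0 = climb j.+1 + climb j.
    by split.
  have ss : forall x, s j.+1 x 0 = Mmx p q1 q2 j.+1 x 0 * (2 + s j 0 0)
       + Mmx p q1 q2 j.+1 x 1 * (1 + s j 1 0).
    have o1 : lift ord0 ord0 = 1 :> 'I_2 by apply/val_inj.
    by move=> x; rewrite sS mxE !big_ord_recl big_ord0 addr0 o1 ![(c + _) _ _]mxE !mxE.
  rewrite !ss IH0 {ss sS IH0}; case: j IH1 p0 h => [|j] IH1 p0 h.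
    have -> : climb 1 = (1 + (q1 1 + q2 1)) / p 1.
      by rewrite -[LHS](mulKf p0) climb1 mulr1 mulrC.
    rewrite !mxE/= (_ : q1 1%N = 1 - q2 1%N - p 1%N); last by rewrite -h; ring.
    by rewrite /climb /=; split; field.
  have -> : climb j.+2 = (1 + (q1 j.+2 + q2 j.+2) * climb j.+1 + q2 j.+2 * climb j) / p j.+2.
    by rewrite -[LHS](mulKf p0) climbSS mulrC.
  rewrite IH1// !mxE/= (_ : q1 j.+2 = 1 - q2 j.+2 - p j.+2); last by rewrite -h; ring.
  by split; field.
rewrite -[LHS](subrK 1) -(hs i).1 addrC; congr (_ + _).
rewrite /s summxE; apply: eq_bigr => k _.
by rewrite -mulmxA [RHS]mxE !big_ord_recl big_ord0 !mxE/= mul1r mul0r !addr0.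
Qed.

Definition window i n : pred nat := fun x => (i <= x <= n)%N.

Lemma Mtilde_ge0 k a b : 0 <= Mtilde p q1 q2 k a b.
Proof.
have [_ ? ? ? _] := par_ge0 k; rewrite mxE.
by case: a b => [[|[|//]] ha] [[|[|//]] hb]/=; rewrite ?divr_ge0// addr_ge0.
Qed.

Lemma Smx_ge0 i n a b : 0 <= Smx p q1 q2 i n a b.
Proof.
rewrite /Smx summxE; apply: sumr_ge0 => k _.
rewrite /desc_prod; elim: (_ - _).+1 a b => [|m IH] a b.
  by rewrite big_geq// mxE ler0n.
by rewrite big_nat_recr//=; apply: mulmx_ge0 => c; [exact: IH|exact: Mtilde_ge0].
Qed.

(** The increments of the potential are propagated by the matrices [Mtilde]; the
    potential vanishes at n + 1, so it is the sum of its increments, and the two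
    first increments are affine in the unknown w i. *)
Lemma window_exit i n j w : (1 < i)%N -> (i <= n)%N -> (j < i)%N ->
  green (window i n) (ind (pred1 j)) w ->
  let e1 : 'rV[R]_2 := delta_mx 0 0 in
  w i = (e1 *m Smx p q1 q2 i n *m \col_k [:: w i.-1; w i.-2 - w i.-1]`_k) 0 0 /
        (1 + (e1 *m Smx p q1 q2 i n *m e1^T) 0 0).
Proof.
move=> i1 iN ji g e1.
pose dw k := w k - w k.+1.
pose D k : 'cV[R]_2 := \col_l [:: dw k; dw k.-1]`_l.
have DS k : (i <= k <= n)%N -> D k = Mtilde p q1 q2 k *m D k.-1.
  move=> ik; have [p0 _ _ _ h] := par_ge0 k.
  have wk : w k = step w k.
    rewrite [LHS](green_fix k g) killT// /ind /= gtn_eqF ?add0r//; lia.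
  have p1 := lt0r_neq0 p0.
  apply/colP => l; rewrite !mxE !big_ord_recl big_ord0 !mxE/=.
  case: l => [[|[|//]] hl] /=; last by rewrite /dw mul1r mul0r !addr0.
  rewrite addr0 mulrAC [X in _ + X]mulrAC -mulrDl; apply: (canRL (mulfK p1)).
  have [k1 k2] : k.-1.+1 = k /\ k.-2.+1 = k.-1 by lia.
  rewrite /dw k1 k2; move: wk; rewrite /step => wk.
  have e : (q1 k + q2 k + p k) * w k = w k by rewrite h mul1r.
  lra.
have Dk k : (i <= k <= n)%N -> D k = desc_prod (Mtilde p q1 q2) k (k - i).+1 *m D i.-1.
  elim: k => [|k IH] ik; first lia.
  rewrite DS//= ; have [ki|ki] := ltnP k i.
    have -> : i = k.+1 by lia.
    by rewrite subnn desc_prod1.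
  by rewrite IH ?subSn// ?desc_prodS ?mulmxA//; lia.
have SD : (Smx p q1 q2 i n *m D i.-1) 0 0 = w i.
  rewrite /Smx mulmx_suml summxE.
  rewrite (eq_big_nat _ _ (F2 := fun k => - w k.+1 - - w k)); last first.
    by move=> k ik; rewrite -Dk// mxE/= /dw addrC opprK.
  rewrite (telescope_sumr (fun k => - w k)); last lia.
  rewrite (green_off g (x := n.+1)); last by rewrite /window; lia.
  by rewrite /ind/= gtn_eqF ?opprK ?oppr0 ?add0r//; lia.
set S := Smx _ _ _ _ _ in SD *; set c0 := \col_k _.
(* w i.-1 and w i.-2 are boundary values, w i is the unknown *)
have De : D i.-1 = c0 - w i *: e1^T.
  apply/colP => l; rewrite !mxE.
  by case: l => [[|[|//]] hl] /=; rewrite /dw ?mulr0 ?subr0 ?mulr1//;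
    do ?congr (_ - w _); lia.
have e1E (A : 'cV[R]_2) : (e1 *m A) 0 0 = A 0 0.
  by rewrite mxE !big_ord_recl big_ord0 !mxE/= mul1r mul0r !addr0.
have S0 : 0 <= (e1 *m S *m e1^T) 0 0.
  by rewrite -mulmxA e1E; apply: mulmx_ge0 => c; [exact: Smx_ge0|rewrite !mxE ler0n].
have S1 : 1 + (e1 *m S *m e1^T) 0 0 != 0 by rewrite gt_eqF// ltr_wpDr.
apply: (canRL (mulfK S1)); rewrite -!mulmxA !e1E mulrDr mulr1.
move: SD; rewrite De mulmxBr -scalemxAr [LHS]mxE [X in _ + X = _]mxE.
by rewrite [X in _ - X = _]mxE => /(canRL (subrK _)).
Qed.

End Potential.

(** * Paths of the chain *)

Section Chain.
Context {R : realType} {d : measure_display} {Omega : measurableType d}.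
Variables (p q1 q2 : nat -> R).
Variables (P : nat -> probability Omega R) (X : nat -> Omega -> nat).
Hypothesis hpar : walk_parameters p q1 q2.
Hypothesis hX : markov_chain (walk_trans p q1 q2) P X.

Local Notation step := (step p q1 q2).
Local Notation kill := (kill p q1 q2).
Local Notation green := (green p q1 q2).
Local Notation Q := (walk_trans p q1 q2).

Lemma measurable_visit n (B : set nat) : measurable [set w | B (X n w)].
Proof.
case: hX => mX _ _; have := mX n measurableT B (I : measurable B).
by rewrite setTI.
Qed.

(** The event that X m, X (m + 1), ... satisfy the predicates of the list, and its
    probability for the walk at x at time m. *)
Fixpoint follows (m : nat) (gs : seq (pred nat)) : set Omega :=
  if gs is g :: gs' then [set w | g (X m w)] `&` follows m.+1 gs' else setT.

Fixpoint follow_prob (gs : seq (pred nat)) (x : nat) : R :=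
  if gs is g :: gs' then (if g x then step (follow_prob gs') x else 0) else 1.

Lemma measurable_follows m gs : measurable (follows m gs).
Proof.
elim: gs m => [|g gs IH] m /=; first exact: measurableT.
by apply: measurableI; [exact: (measurable_visit m [set x | g x])|exact: IH].
Qed.

Lemma follow_prob_ge0 gs x : 0 <= follow_prob gs x.
Proof.
elim: gs x => [|g gs IH] x //=; case: ifP => // _.
exact: (step_ge0 hpar).
Qed.

Definition history (x : nat -> nat) (m : nat) : set Omega :=
  [set w | forall k, (k <= m)%N -> X k w = x k].

Lemma measurable_history x m : measurable (history x m).
Proof.
elim: m => [|m IH].
  rewrite (_ : history x 0 = [set w | [set x 0%N] (X 0%N w)]).
    exact: measurable_visit.
  apply/seteqP; split => w /=; first by apply.
  by move=> h [|].
rewrite (_ : history x m.+1 = history x m `&` [set w | [set x m.+1] (X m.+1 w)]).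
  by apply: measurableI => //; exact: measurable_visit.
apply/seteqP; split => w /=.
  by move=> h; split; [move=> k km; apply: h; exact: leqW|exact: h].
by move=> [h e] k; rewrite leq_eqVlt => /predU1P[->//|]; exact: h.
Qed.

(** The Markov property is given for complete histories, so the induction runs over
    the conditions on the future with an arbitrary past, to which the next
    position is added. *)
Lemma history_follows i gs x m :
  (P i (history x m `&` follows m gs)
   = P i (history x m) * (follow_prob gs (x m))%:E)%E.
Proof.
elim: gs x m => [|g gs IH] x m /=; first by rewrite setIT mule1.
case: ifP => gx; last first.
  rewrite mule0 (_ : _ `&` _ = set0) ?measure0//.
  apply/seteqP; split => w //= [h [+ _]].
  by rewrite (h m)// gx.
(* the history x continued by the position y at time m + 1 *)
pose ext y k := if k == m.+1 then y else x k.
have extx y k : (k <= m)%N -> ext y k = x k by move=> km; rewrite /ext ltn_eqF.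
have extm y : ext y m.+1 = y by rewrite /ext eqxx.
have hext y : history (ext y) m.+1 =
    [set w | (forall k, (k <= m)%N -> X k w = x k) /\ X m.+1 w = y].
  apply/seteqP; split => w /=.
    move=> h; split; last by rewrite h.
    by move=> k km; rewrite h ?extx//; exact: leqW.
  move=> [h e] k; rewrite leq_eqVlt => /predU1P[->|km]; first by rewrite extm.
  by rewrite h// extx.
have -> : history x m `&` ([set w | g (X m w)] `&` follows m.+1 gs) =
    \bigcup_y (history (ext y) m.+1 `&` follows m.+1 gs).
  apply/seteqP; split => w /=.
    move=> [h [_ f]]; exists (X m.+1 w) => //; split=> //.
    by rewrite hext.
  move=> [y _ [+ f]]; rewrite hext => -[h _]; split=> //; split=> //.
  by rewrite /= h.
rewrite measure_semi_bigcup; last 3 first.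
- by move=> y; apply: measurableI; [exact: measurable_history|exact: measurable_follows].
- move=> y z _ _ [w [[]]]; rewrite hext => -[_ <-] _ [].
  by rewrite hext => -[_ <-].
- apply: bigcup_measurable => y _.
  by apply: measurableI; [exact: measurable_history|exact: measurable_follows].
have fP : P i (history x m) \is a fin_num.
  exact/fin_num_measure/measurable_history.
transitivity (\sum_(y <oo) (fine (P i (history x m)) * (Q (x m) y * follow_prob gs y))%:E)%E.
  apply: eq_eseriesr => y _; etransitivity; first exact: IH.
  rewrite extm hext.
  case: hX => _ _ ->; rewrite -[X in (X * _ * _)%E](fineK fP).
  by rewrite -!EFinM mulrA.
under eq_eseriesr do rewrite EFinM.
rewrite nneseriesZl; last first.
  by move=> y _; rewrite lee_fin mulr_ge0 ?follow_prob_ge0// trans_ge0.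
by rewrite row_sum// fineK.
Qed.

Lemma follows_start i gs : (P i (follows 0 gs) = (follow_prob gs i)%:E)%E.
Proof.
have e : history (fun=> i) 0 = [set w | X 0 w = i].
  apply/seteqP; split => w /=; first by apply.
  by move=> h [|].
have P1 : (P i (history (fun=> i) 0) = 1)%E by rewrite e; case: hX.
have mh := measurable_history (fun=> i) 0.
transitivity (P i (follows 0 gs `\` history (fun=> i) 0)
              + P i (follows 0 gs `&` history (fun=> i) 0))%E.
  exact: (measureDI (P i) (measurable_follows 0 gs) mh).
rewrite [X in (X + _)%E](_ : _ = 0%E).
  by rewrite add0e setIC history_follows P1 mul1e.
apply/eqP; rewrite eq_le measure_ge0 andbT.
apply: (@le_trans _ _ (P i (~` history (fun=> i) 0))).
  apply: le_measure; last by move=> w [].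
    by rewrite inE; exact: measurableD (measurable_follows _ _) mh.
  by rewrite inE; exact: measurableC.
by rewrite probability_setC// P1 subee.
Qed.

Lemma follows_nseq A m n gs w : follows m (nseq n A ++ gs) w <->
  (forall k, (k < n)%N -> A (X (m + k)%N w)) /\ follows (m + n) gs w.
Proof.
elim: n m => [|n IH] m /=; first by rewrite addn0; split=> [|[]].
rewrite IH addSnnS; split.
  move=> [h0 [h f]]; split=> // -[|k]; first by rewrite addn0.
  by rewrite ltnS addnS -addSn => /h.
move=> [h f]; split; first by have := h 0%N isT; rewrite addn0.
by split=> // k kn; rewrite addSnnS; apply: h.
Qed.

Lemma follow_prob_nseq A n gs :
  follow_prob (nseq n A ++ gs) = iter n (kill A) (follow_prob gs).
Proof. by elim: n => [|n IH] //=; rewrite IH. Qed.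

(** The exit time m decomposes the event into disjoint ones, whose probabilities are
    the terms of the series that defines the potential. *)
Lemma exit_probE (i j : nat) (A : set nat) (A' : pred nat) w :
  (forall x, A x <-> A' x) -> ~~ A' j -> green A' (ind (pred1 j)) w ->
  exit_prob P X i A j = w i.
Proof.
move=> AA' Aj g; rewrite /exit_prob.
pose F m := follows 0 (nseq m A' ++ [:: (pred1 j : pred nat)]).
have FE m w' : F m w' <-> (forall k, (k < m)%N -> A' (X k w')) /\ X m w' = j.
  rewrite /F follows_nseq/= add0n; split=> [[h [/eqP ? _]]|[h ->]]; split=> //.
rewrite (_ : [set _ | _] = \bigcup_m F m); last first.
  apply/seteqP; split => w' /=.
    move=> [m [[e] _ h]]; exists m => //; apply/FE; split=> // k km.
    by apply/AA'/h.
  move=> [m _ /FE[h e]]; exists m; split.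
  - by rewrite e.
  - by rewrite e => /AA'; apply/negP.
  - by move=> k km; apply/AA'/h.
rewrite measure_semi_bigcup; last 3 first.
- by move=> m; exact: measurable_follows.
- move=> m n _ _ [w' [/FE[hm em] /FE[hn en]]].
  have [mn|nm|//] := ltngtP m n.
    by move: (hn m mn); rewrite em (negbTE Aj).
  by move: (hm n nm); rewrite en (negbTE Aj).
- by apply: bigcup_measurable => m _; exact: measurable_follows.
rewrite (@eq_eseriesr _ _ (fun m => (iter m (kill A') (ind (pred1 j)) i)%:E)); last first.
  move=> m _; etransitivity; first exact: follows_start.
  rewrite follow_prob_nseq; congr (_%:E).
  apply: iter_kill_eq => x /=; rewrite /ind (step_cst hpar) /=.
  by case: (x == j).
by rewrite (eseries_EFin (g i)).
Qed.

(** * First passage times *)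

(** A time is the number of the n that it exceeds. *)
Lemma first_time_series (B : set nat) (A : pred nat) w : (forall x, B x <-> ~~ A x) ->
  first_time (R := R) X B w = (\sum_(0 <= n <oo) (\1_(follows 1 (nseq n A)) w)%:E)%E.
Proof.
move=> BA; have SE n : follows 1 (nseq n A) w <->
    forall k, (0 < k <= n)%N -> A (X k w).
  have := follows_nseq A 1 n [::] w; rewrite cats0 => ->; split.
    by move=> [h _] [|k] // kn; exact: h.
  by move=> h; split=> // k kn; exact: h.
have [[n [n0 Bn]]|no] := pselect (exists n, (0 < n)%N /\ B (X n w)); last first.
  rewrite /first_time (_ : [set _ | _ in _] = set0); last first.
    by apply/seteqP; split=> x //= [n hn _]; apply: no; exists n.
  rewrite ereal_inf0; apply/esym/eqyP => a a0.
  have one n : \1_(follows 1 (nseq n A)) w = 1 :> R.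
    rewrite indicE mem_set//; apply/SE => k /andP[k0 _].
    by apply: contra_notT no => Ak; exists k; split => //; apply/BA.
  apply: (@le_trans _ _ (\sum_(0 <= n < Num.bound a) (\1_(follows 1 (nseq n A)) w)%:E)%E).
    rewrite sumEFin lee_fin (eq_bigr (fun=> 1)) => [|n _]; last exact: one.
    by rewrite big_const_nat subn0 iter_addr addr0 ltW// archi_boundP// ltW.
  by apply: nneseries_lim_ge => n _ _; rewrite lee_fin one.
have ex : exists n, (0 < n)%N && ~~ A (X n w).
  by exists n; rewrite n0; apply/BA.
case: (ex_minnP ex) => N /andP[N0 AN] Nmin.
rewrite /first_time (_ : ereal_inf _ = N%:R%:E); last first.
  apply/eqP; rewrite eq_le; apply/andP; split.
    by apply: ereal_inf_lbound; exists N => //; split=> //; apply/BA.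
  apply: le_ereal_inf_tmp => _ [k [k0 Bk] <-].
  by rewrite lee_fin ler_nat; apply: Nmin; rewrite k0; apply/BA.
have ind1 k : (k < N)%N -> \1_(follows 1 (nseq k A)) w = 1 :> R.
  move=> kN; rewrite indicE mem_set//; apply/SE => l /andP[l0 lk].
  apply: contraT => Al; have := Nmin l; rewrite l0 Al => /(_ isT); lia.
have ind0 k : (N <= k)%N -> \1_(follows 1 (nseq k A)) w = 0 :> R.
  move=> Nk; rewrite indicE memNset// => /SE/(_ N).
  by rewrite N0 Nk (negbTE AN) => /(_ isT).
rewrite (@eseries_EFin _ _ N%:R)//.
have := cvg_sum_finsupp ind0; rewrite big_nat (eq_bigr (fun=> 1)); last first.
  by move=> k /andP[_ /ind1].
by rewrite -big_nat big_const_nat subn0 iter_addr addr0.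
Qed.

Lemma expect_first_time (x : nat) (B : set nat) (A : pred nat) :
  (forall x, B x <-> ~~ A x) ->
  (E_ P x (first_time X B) = \sum_(0 <= n <oo) (step (iter n (kill A) (fun=> 1%R)) x)%:E)%E.
Proof.
move=> BA; rewrite /E_.
have mS n : measurable (follows 1 (nseq n A)) by exact: measurable_follows.
under eq_integral do rewrite (first_time_series _ BA).
rewrite integral_nneseries; last 3 first.
- exact: measurableT.
- move=> n; exact/measurable_realfun.measurable_EFinP/measurable_realfun.measurable_indic.
- by move=> n w _; rewrite lee_fin.
apply: eq_eseriesr => n _; rewrite integral_indic// setIT.
have -> : follows 1 (nseq n A) = follows 0 (xpredT :: nseq n A).
  by apply/seteqP; split=> [w h|w []].
etransitivity; first exact: follows_start.
by rewrite /= -[nseq n A]cats0 follow_prob_nseq.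
Qed.

Lemma expect_first_time_green (x : nat) (B : set nat) (A : pred nat) w :
  (forall x, B x <-> ~~ A x) -> green A (ind A) w ->
  (E_ P x (first_time X B) = (1 + step w x)%:E)%E.
Proof.
move=> BA g; rewrite (expect_first_time _ BA).
exact: eseries_EFin (return_cvg hpar (x := x) g).
Qed.

Lemma recurrence_level1 : (E_ P 1 (tau X 1) < +oo)%E ->
  green (leq 1) (ind (leq 1)) (pot p q1 q2 (leq 1) (ind (leq 1))).
Proof.
rewrite /tau (@expect_first_time 1 [set k | (k < 1)%N] (leq 1)); last by move=> x /=; lia.
set S := (\sum_(0 <= n <oo) _)%E => Sfin.
have S0 n : (0 <= (step (iter n (kill (leq 1)) (fun=> 1%R)) 1)%:E)%E.
  by rewrite lee_fin; apply: (step_ge0 hpar) => y; exact: iter_kill_ge0.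
have fS : S \is a fin_num by rewrite ge0_fin_numE// nneseries_ge0.
apply: (@green_leq1_of_bound _ _ _ _ hpar (fine S)) => n.
rewrite -lee_fin fineK//; apply: le_trans (@nneseries_lim_ge _ _ _ _ n _); last first.
  by move=> m _ _; exact: S0.
rewrite sumEFin lee_fin /psum; apply: ler_sum => m _.
rewrite -[leRHS]/(iter m.+1 (kill (leq 1)) (fun=> 1) 1%N) iterSr.
by rewrite (iter_kill_eq _ _ _ _ _ (kill1 hpar (leq 1))).
Qed.

End Chain.

(** * The stationary distribution and the explicit expressions *)

Theorem theorem1p2 (R : realType) (p q1 q2 : nat -> R)
  (d : measure_display) (Omega : measurableType d)
  (P : nat -> probability Omega R) (X : nat -> Omega -> nat)
  (hpar : walk_parameters p q1 q2)
  (hX : markov_chain (walk_trans p q1 q2) P X)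
  (htau : (E_ P 1 (tau X 1) < +oo)%E) :
  let e1 : 'rV[R]_2 := delta_mx 0 0 in
  let e2 : 'rV[R]_2 := delta_mx 0 1 in
  let v : 'cV[R]_2 := e1^T - e2^T in
  [/\ positive_recurrent P X,
      exists pi : nat -> R,
        [/\ stationary (walk_trans p q1 q2) pi,
            forall mu, stationary (walk_trans p q1 q2) mu -> mu = pi,
            forall i : nat, (pi i)%:E = ((E_ P i (T_ X i))^-1)%E &
            forall i : nat,
              (pi i)%:E = ((stationary_denom P X p q1 q2 i)^-1)%E],
      forall i : nat, (2 <= i)%N ->
        (forall n : nat, (i <= n)%N ->
           exit_below P X i n (i%:Z - 1)
             = (e1 *m Smx p q1 q2 i n *m v) 0 0
               / (1 + (e1 *m Smx p q1 q2 i n *m e1^T) 0 0) /\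
           exit_below P X i n (i%:Z - 2)
             = (e1 *m Smx p q1 q2 i n *m e2^T) 0 0
               / (1 + (e1 *m Smx p q1 q2 i n *m e1^T) 0 0)) /\
        (forall j : int, j = i%:Z - 1 \/ j = i%:Z - 2 ->
           exit_below P X i n j @[n --> \oo] --> exit_below_oo P X i j),
      forall i : nat, (1 <= i)%N ->
        cvgn (N_series P X p q1 i) /\
        E_ P i (tau X i)
          = (1 + dot (mx_of_rows 1 3 [:: [:: 2; 2; 1]])
                     ((1 - alpha P X p q1 i - beta P X p q1 i)^-1
                      *: mx_of_rows 1 3 [:: [:: q1 i; gamma P X p i; q2 i]]
                      *m limn (N_series P X p q1 i)))%:E &
      forall i : nat,
        E_ P i (T_ X i.+1)
          = (1 + \sum_(1 <= k < i.+1)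
                   (e1 *m desc_prod (Mmx p q1 q2) i k
                       *m (mx_of_rows 1 2 [:: [:: 2; 1]])^T) 0 0)%:E].
Proof.
move=> e1 e2 v.
have hrec := recurrence_level1 hpar hX htau.
have hitE (x i : nat) : (E_ P x (T_ X i) = (1 + step p q1 q2 (hit p q1 q2 i) x)%:E)%E.
  apply: (@expect_first_time_green _ _ _ _ _ _ _ _ hpar hX x [set i] (predC1 i)).
    by move=> y /=; split=> [->|/negPn/eqP]; rewrite ?eqxx.
  exact: hitP.
have hitE' (x i : nat) : x != i -> (E_ P x (T_ X i) = (hit p q1 q2 i x)%:E)%E.
  by move=> xi; rewrite hitE -hit_step.
have lifeE (i : nat) : (0 < i)%N -> (E_ P i (tau X i) = (life p q1 q2 i i)%:E)%E.
  move=> i0; have g := lifeP hpar hrec i0.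
  rewrite /tau gtn_eqF// (@expect_first_time_green _ _ _ _ _ _ _ _ hpar hX i
    [set k | (k < i)%N] (leq i) (life p q1 q2 i))//.
    by rewrite [in RHS](green_fix i g) killT// /ind leqnn.
  by move=> x /=; lia.
have exitE (i j : nat) : (j < i)%N ->
    exit_below_oo P X i j = pot p q1 q2 (leq i) (ind (pred1 j)) i.
  move=> ji; apply: (@exit_probE _ _ _ _ _ _ _ _ hpar hX i j [set k | (i <= k)%N] (leq i)) => //; first by rewrite -ltnNge.
  by have [] := @exit_green _ _ _ _ hpar (leq i) (pred1 j); first by move=> x /= /eqP->; lia.
have exit1 (k : nat) : exit_below_oo P X k.+1 k = down1 p q1 q2 k.+1 k.+1 by exact: exitE.
have predZ (k : nat) : (0 < k)%N -> k%:Z - 1 = k.-1 by lia.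
have exit2 (k : nat) : (0 < k)%N -> exit_below_oo P X k.+1 (k%:Z - 1) = down2 p q1 q2 k.+1 k.+1.
  by move=> k0; rewrite predZ// exitE//; lia.
have gammaE (k : nat) : (0 < k)%N -> gamma P X p k = twostep p q1 q2 k.
  by move=> k0; rewrite /gamma exit2.
have alphaE (k : nat) : (0 < k)%N -> alpha P X p q1 k = direct p q1 q2 k.
  move=> k0; have [_ _ h _ _] := par_ge0 hpar k.+1.
  by rewrite /alpha exit1 gammaE// split_down1// lerDl twostep_ge0.
have betaE (k : nat) : (0 < k)%N -> beta P X p q1 k = indirect p q1 q2 k.
  move=> k0; have [_ _ h _ _] := par_ge0 hpar k.+1.
  by rewrite /beta exit1 gammaE// split_down1// ?lerDr ?twostep_ge0.
have invE (i : nat) : ((ret p q1 q2 i)^-1)%:E = ((ret p q1 q2 i)%:E^-1)%E.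
  by rewrite inver gt_eqF// (lt_le_trans _ (ret_ge1 hpar hrec i)).
have denomE (i : nat) : (stationary_denom P X p q1 q2 i = (ret p q1 q2 i)%:E)%E.
  rewrite /stationary_denom lifeE//; case: i => [|i].
    rewrite (_ : 0%:Z - 1 = Negz 0)// (_ : 0%:Z - 2 = Negz 1)// /E_ !mule0 !adde0.
    rewrite ret0E//; case: hpar => -> _ _ _.
    by rewrite mul1e -EFinD addrC.
  rewrite exit2// predZ// hitE'; last lia.
  rewrite (retE hpar hrec (ltn0Sn i)) !EFinD !EFinM.
  case: i => [|i]; first by rewrite (_ : 1%:Z - 2 = Negz 0)// /E_ mule0.
  by rewrite (_ : i.+2%:Z - 2 = i); [rewrite hitE'//; lia|lia].
split.
- by move=> i; rewrite hitE ltry.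
- exists (fun i => (ret p q1 q2 i)^-1); split.
  + exact: stationary_ret.
  + by move=> mu; exact: stationaryE.
  + by move=> i; rewrite invE hitE.
  + by move=> i; rewrite invE denomE.
- move=> i i2; have pre1 : i%:Z - 1 = i.-1 by lia.
  have pre2 : i%:Z - 2 = i.-2 by lia.
  have i1 : (i.-1 < i)%N by lia.
  have i2' : (i.-2 < i)%N by lia.
  have win (n j : nat) : (j < i)%N -> exit_below P X i n j = pot p q1 q2 (window i n) (ind (pred1 j)) i
      /\ green p q1 q2 (window i n) (ind (pred1 j)) (pot p q1 q2 (window i n) (ind (pred1 j))).
    move=> ji; have [|g _ _] := @exit_green _ _ _ _ hpar (window i n) (pred1 j).
      by move=> x /= /eqP->; rewrite /window; lia.
    split=> //; apply: (@exit_probE _ _ _ _ _ _ _ _ hpar hX i j [set k | (i <= k <= n)%N]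
      (window i n)) => //.
    by rewrite /window; lia.
  split.
    move=> n iN; rewrite pre1 pre2; split.
      have [-> g] := win n _ i1; rewrite (window_exit hpar i2 iN i1 g) -/e1.
      congr ((_ *m _) _ _ / _); apply/colP => l; rewrite !mxE.
      rewrite (green_off g) ?(green_off (x := i.-2) g); try by rewrite /window; lia.
      rewrite /ind/= eqxx (_ : (i.-2 == i.-1) = false); last lia.
      by case: l => [[|[|//]] hl] /=; rewrite ?subr0 ?sub0r.
    have [-> g] := win n _ i2'; rewrite (window_exit hpar i2 iN i2' g) -/e1.
    congr ((_ *m _) _ _ / _); apply/colP => l; rewrite !mxE.
    rewrite (green_off g) ?(green_off (x := i.-2) g); try by rewrite /window; lia.
    rewrite /ind/= eqxx (_ : (i.-1 == i.-2) = false); last lia.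
    by case: l => [[|[|//]] hl] /=; rewrite ?subr0 ?sub0r.
  have cv (j : nat) : (j < i)%N -> exit_below P X i n j @[n --> \oo] --> exit_below_oo P X i j.
    move=> ji; rewrite exitE//.
    apply: (@eq_cvgn _ _ (fun n => pot p q1 q2 (window i n) (ind (pred1 j)) i)).
      by move=> n; have [] := win n j ji.
    apply: (@green_approx _ _ _ _ hpar (leq i) (ind (pred1 j))
      (pot p q1 q2 (leq i) (ind (pred1 j))) (window i) (fun=> ind (pred1 j))
      (fun n => pot p q1 q2 (window i n) (ind (pred1 j)))).
    + exact: ind_ge0.
    + by have [] := @exit_green _ _ _ _ hpar (leq i) (pred1 j); first by move=> x /= /eqP->; lia.
    + by move=> N y; rewrite ind_ge0 lexx.
    + by move=> N y /andP[].
    + by move=> N y yN; rewrite /window yN andbT.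
    + by move=> N; have [] := win N j ji.
  by move=> j [->|->]; rewrite ?pre1 ?pre2; exact: cv.
- move=> i i0.
  have NE n : N_series P X p q1 i n = progeny p q1 q2 i n.
    apply: eq_big_nat => k /andP[ik _]; apply: eq_big_nat => l /andP[il _].
    have l0 : (0 < l)%N by lia.
    by rewrite /Nmx /offspring alphaE// betaE// direct_indirect.
  pose L : 'M[R]_3 := \matrix_(a, b) limn (fun n => progeny p q1 q2 i n a b).
  have cL a b : progeny p q1 q2 i n a b @[n --> \oo] --> L a b.
    by rewrite mxE; exact: progeny_entry_cvg.
  have cN : N_series P X p q1 i n @[n --> \oo] --> L.
    by apply: cvgn_mx => a b; apply: eq_cvgn (cL a b) => n; rewrite NE.
  split; first exact: cvgP cN.
  rewrite (cvg_lim _ cN)// lifeE// alphaE// betaE// direct_indirect// gammaE//.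
  by rewrite (life_progeny hpar hrec i0 cL).
- by move=> i; rewrite hitE' ?ltn_eqF// hit_below// hit_self// addr0 climb_matrix.
Qed.
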